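(* Let $p,q \ge 2$ be integers. There is a tight orientably-regular polyhedron of type $\{p,q\}$ if and only if one of the following holds: (a) $p$ and $q$ are both even; (b) $p$ is odd and $q$ is an even divisor of $2p$; (c) $q$ is odd and $p$ is an even divisor of $2q$.
   Context: A polyhedron is an abstract polytope of rank $3$ (a ranked poset with ranks $-1$ to $3$, unique least and greatest faces, flags of $5$ faces, connected sections, and the diamond condition). It has type $\{p,q\}$ if every $2$-face is a $p$-gon and every vertex-figure a $q$-gon; it is tight if it has exactly $2pq$ flags. It is regular if its automorphism group acts transitively on flags, in which case the group is generated by the reflections $\rho_0,\rho_1,\rho_2$ with respect to a base flag; it is orientably-regular if the rotation subgroup $\langle\rho_0\rho_1,\rho_1\rho_2\rangle$ has index $2$ in the automorphism group. *)

(* Defs.v *)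
From HB Require Import structures.
From mathcomp Require Import all_boot all_order all_algebra all_fingroup.

Set Implicit Arguments.
Unset Strict Implicit.
Unset Printing Implicit Defensive.

Import Order.TTheory GRing.Theory Num.Theory.

Local Open Scope order_scope.

(* Face posets are taken finite.  This loses nothing for tight polyhedra: they
   have finitely many flags, every flag is finite, and every face lies in a
   flag.  The least and greatest faces are the \bot and \top of the order. *)

Section FacePoset.

Variables (d : Order.disp_t) (P : finTBPOrderType d).

Definition is_chain (A : {set P}) : bool :=
  [forall x in A, forall y in A, x >=< y].

Definition flags : {set {set P}} := [set A | maxset is_chain A].

Definition automorphisms : {set {perm P}} :=
  [set s : {perm P} | [forall x, forall y, (s x <= s y) == (x <= y)]].

Lemma automorphisms_group_set : group_set automorphisms.
Proof.
apply/group_setP; split.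
  by rewrite inE; apply/forallP=> x; apply/forallP=> y; rewrite !perm1.
move=> s t; rewrite !inE => /forallP hs /forallP ht.
apply/forallP=> x; apply/forallP=> y; rewrite !permM.
by rewrite (eqP (forallP (ht _) _)) (eqP (forallP (hs _) _)).
Qed.

Canonical automorphisms_group := Group automorphisms_group_set.

Definition regular : bool := [transitive automorphisms, on flags | 'P^*].

Definition tight (p q : nat) : Prop := #|flags| = (2 * p * q)%N.

(* The proper faces of the section y / x = {z | x <= z <= y}. *)
Definition proper_section (x y : P) : {set P} := [set z | x < z < y].

Definition section_connected (x y : P) : Prop :=
  {in proper_section x y &, forall z w,
    connect (fun u v => [&& u \in proper_section x y,
                            v \in proper_section x y & u >=< v]) z w}.

Section Ranked.

Variable rk : P -> int.

(* The rank of the section y / x is rk y - rk x - 1; sections of rank at most 1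
   are connected by convention. *)
Definition is_polyhedron : Prop :=
  [/\ {homo rk : x y / x < y},
      forall i : int, (i \in codom rk) = (- 1 <= i <= 3)%R,
      forall A, A \in flags -> #|A| = 5%N,
      forall x y : P, x <= y -> (2 <= rk y - rk x - 1)%R -> section_connected x y
    & forall x y : P, x <= y -> rk y = (rk x + 2)%R ->
        #|proper_section x y| = 2%N].

Definition adjacent (i : int) (A B : {set P}) : bool :=
  (A != B) && ([set x in A | rk x != i] == [set x in B | rk x != i]).

Definition is_reflection (A : {set P}) (i : int) (s : {perm P}) : bool :=
  (s \in automorphisms) && adjacent i A (s @: A).

(* By regularity the choice of base flag A is immaterial, and rho_i is the
   unique automorphism sending A to its i-adjacent flag. *)
Definition orientably_regular : Prop :=
  regular /\
  exists A : {set P}, exists rho0 rho1 rho2 : {perm P},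
    [/\ A \in flags,
        is_reflection A 0 rho0, is_reflection A 1 rho1, is_reflection A 2 rho2
      & #|automorphisms : <<[set rho0 * rho1; rho1 * rho2]>>|%g = 2%N].

End Ranked.

End FacePoset.

(* The vertices (inl) and edges (inr) of an n-gon: edge j joins the vertices j
   and j + 1 mod n.  The digon n = 2 has two edges on the same two vertices. *)
Definition polygon_le (n : nat) : rel ('I_n + 'I_n)%type :=
  fun a b =>
    match a, b with
    | inl i, inl j => i == j
    | inr i, inr j => i == j
    | inl i, inr j => (i == j) || (i == ordS j)
    | inr _, inl _ => false
    end.

(* The section y / x is isomorphic to the face poset of an n-gon. *)
Definition is_polygon (d : Order.disp_t) (P : finTBPOrderType d) (n : nat)
    (x y : P) : Prop :=
  exists f : 'I_n + 'I_n -> P,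
    [/\ injective f,
        {mono f : a b / @polygon_le n a b >-> a <= b}
      & codom f =i proper_section x y].

Definition has_type (d : Order.disp_t) (P : finTBPOrderType d) (rk : P -> int)
    (p q : nat) : Prop :=
  (forall F : P, rk F = 2%R -> is_polygon p \bot F) /\
  (forall v : P, rk v = 0%R -> is_polygon q v \top).

(* Main.v *)
(* Necessity.  Let x = rho0 rho1, y = rho1 rho2 and t = rho1.  Automorphisms act
   freely on flags and <rho0, rho1> is transitive on the flags of a face, so x
   and y have orders p and q; <x> and <y> meet trivially and tightness gives
   <x><y> = the rotation group, of order pq.  It contains the involution xy, so
   pq is even.  If p is odd then y^2 commutes with x, by induction on pq: the
   groups N = <y> :&: <y>^(xy) and M = <x> :&: <x>^(xy) are normal, since the
   involution xy swaps the two conjugates.  If N is nontrivial, induction modulo N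
   shows that x normalises <y^2>, on which it acts like the involution xy; as x
   has odd order it centralises y^2.  If N = 1 and M is nontrivial, induction
   modulo M shows that y^2 normalises <x>; since t inverts x and y, y^4 is then
   central, so y^4 lies in N, and y^2 = 1 by parity.  If both are trivial then <x>
   and <y> have the same odd order by counting, so xy = 1.  Finally, (xy)^2 = 1
   gives that the conjugate of x by y^-1 is x^-1 y^-2, whose p-th power is
   y^(-2p), so q divides 2p.

   Sufficiency.  Take 2k vertices, k white and k black indexed by Z_k, edges
   indexed by Z_n x Z_k, and 2-faces indexed by Z_n; the edge (a, b) joins the
   white vertex b to the black vertex b + t a and lies on the faces a and a + 1.
   With t a = a mod k when k divides n, or t a = - [a odd] when n is even, this
   is a tight orientably-regular polyhedron of type {2k, n}.  Duality gives the
   remaining types. *)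

Require Import Defs.
From HB Require Import structures.
From mathcomp Require Import all_boot all_order all_algebra all_fingroup.
From mathcomp Require Import all_solvable zify.

Set Implicit Arguments.
Unset Strict Implicit.
Unset Printing Implicit Defensive.

Import Order.TTheory GRing.Theory Num.Theory.

(** * Products of two cyclic groups *)

Section TightGroup.
Import GroupScope.

(* [x] and [y] play the rotations rho0 rho1 and rho1 rho2, and [t] plays rho1. *)
Definition tight_rotations (gT : finGroupType) (x y t : gT) : Prop :=
  [/\ x ^ t = x^-1, y ^ t = y^-1, (x * y) ^+ 2 = 1,
      <[x]> :&: <[y]> = 1 & commute <[x]> <[y]>].

(** A subgroup of a cyclic group is characteristic in it, so whatever normalises the cyclic group
    normalises the subgroup. *)
Lemma cycle_subgroup_norm (gT : finGroupType) (N : {group gT}) (x t : gT) :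
  N \subset <[x]> -> x ^ t \in <[x]> -> t \in 'N(N).
Proof.
move=> sNx; rewrite -norms_cycle => nxt.
rewrite -cycle_subG; exact: char_norm_trans (cycle_subgroup_char sNx) nxt.
Qed.

(** Group-theoretic form of duality: [y^-1] and [x^-1] take over the roles of [x] and [y], and their
    product is the inverse of [x * y]. *)
Lemma tight_rotationsC (gT : finGroupType) (x y t : gT) :
  tight_rotations x y t -> tight_rotations y^-1 x^-1 t.
Proof.
case=> xt yt xy2 tiXY cXY; split; rewrite ?cycleV ?conjVg ?xt ?yt //.
- by rewrite -invMg expgVn xy2 invg1.
- by rewrite setIC.
Qed.

(* The involution [x * y] swaps [<[y]>] and [<[y]> :^ x * y]. *)
Lemma meet_conj_norm (gT : finGroupType) (x y : gT) :
  (x * y) ^+ 2 = 1 -> x \in 'N(<[y]> :&: <[y]> :^ (x * y)).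
Proof.
move=> xy2; set N := _ :&: _.
have ny : y^-1 \in 'N(N).
  rewrite (@cycle_subgroup_norm _ _ y) ?subsetIl //.
  by rewrite conjgE invgK !groupM ?groupV ?cycle_id.
have nxy : x * y \in 'N(N).
  by apply/normP; rewrite conjIg -conjsgM -expg2 xy2 conjsg1 setIC.
by rewrite -(mulgK y x) groupM.
Qed.

(** Only the trivial intersection needs care: it survives in the quotient because [N] lies inside
    one of the two cyclic factors. *)
Lemma tight_rotations_quotient (gT : finGroupType) (x y t : gT) (N : {group gT}) :
    tight_rotations x y t -> x \in 'N(N) -> y \in 'N(N) -> t \in 'N(N) ->
    (N \subset <[x]>) || (N \subset <[y]>) ->
  tight_rotations (coset N x) (coset N y) (coset N t).
Proof.
case=> xt yt xy2 tiXY cXY nx ny nt sN.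
split.
- by rewrite -morphJ // xt morphV.
- by rewrite -morphJ // yt morphV.
- by rewrite -morphM // -morphX ?groupM // xy2 morph1.
- rewrite -!quotient_cycle //; case/orP: sN => sN.
    by rewrite -quotientGI // tiXY quotient1.
  by rewrite -quotientIG // tiXY quotient1.
- rewrite /commute -!quotient_cycle // -!quotientMl ?cycle_subG //.
  by rewrite cXY.
Qed.

(** An element of odd order is a power of its own square. *)
Lemma odd_commute_sqr (gT : finGroupType) (x c : gT) :
  odd #[x] -> commute c (x ^+ 2) -> commute c x.
Proof.
move=> ox cx2; have : x \in <[x ^+ 2]>.
  by rewrite -cycle_subG; have /eqP-> : generator <[x]> (x ^+ 2);
    rewrite ?generator_coprime ?coprimen2 ?coprime2n.
by case/cycleP=> i ->; apply: commuteX.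
Qed.

Lemma tight_rotations_order_dvd (gT : finGroupType) (x y t : gT) :
  tight_rotations x y t -> commute (y ^+ 2) x -> y ^+ (2 * #[x]) = 1.
Proof.
case=> xt yt xy2 _ _ cyx.
have e : x ^ y^-1 = x^-1 * y ^- 2.
  apply: (mulgI x); apply: (mulIg (y ^+ 2)).
  rewrite mulVKg mulVg conjgE invgK.
  by move: xy2; rewrite !expg2 !mulgA => xy2; rewrite mulgKV.
have : (x ^ y^-1) ^+ #[x] = 1 by rewrite -conjXg expg_order conj1g.
rewrite e expgMn; last by apply: commuteV; apply/commute_sym/commuteV/commute_sym.
rewrite expgVn expg_order invg1 mul1g expgVn -expgM => /eqP.
by rewrite invg_eq1 => /eqP.
Qed.

Lemma tight_rotations_commute (gT : finGroupType) (x y t : gT) :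
  tight_rotations x y t -> odd #[x] -> commute (y ^+ 2) x.
Proof.
have [n] := ubnP (#[x] * #[y])%N.
elim: n => // n IHn in gT x y t *; rewrite ltnS => len rot ox.
have [xt yt xy2 tiXY cXY] := rot.
have ntX (N : {group gT}) : N \subset <[x]> -> t \in 'N(N).
  by move=> sN; apply: (cycle_subgroup_norm sN); rewrite xt groupV cycle_id.
have ntY (N : {group gT}) : N \subset <[y]> -> t \in 'N(N).
  by move=> sN; apply: (cycle_subgroup_norm sN); rewrite yt groupV cycle_id.
have nxX (N : {group gT}) : N \subset <[x]> -> x \in 'N(N).
  by move=> sN; apply: (cycle_subgroup_norm sN); rewrite conjgE mulKg cycle_id.
have nyY (N : {group gT}) : N \subset <[y]> -> y \in 'N(N).
  by move=> sN; apply: (cycle_subgroup_norm sN); rewrite conjgE mulKg cycle_id.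
(* The induction hypothesis modulo a nontrivial [N], with relations in the quotient read back as
   membership in [N]. One factor shrinks strictly and the other does not grow, so the measure
   drops. *)
have quo (N : {group gT}) : x \in 'N(N) -> y \in 'N(N) -> t \in 'N(N) ->
    N != 1 :> {set gT} -> (N \subset <[x]>) || (N \subset <[y]>) ->
    tight_rotations (coset N x) (coset N y) (coset N t) /\
    [~ y ^+ 2, x] \in N /\ y ^+ (2 * #[coset N x]) \in N /\ odd #[coset N x].
  move=> nx ny nt ntN sN.
  have rotN := tight_rotations_quotient rot nx ny nt sN.
  have oxN : odd #[coset N x] by apply: dvdn_odd ox; apply: morph_order.
  have cN : commute (coset N y ^+ 2) (coset N x).
    apply: (IHn _ _ _ (coset N t)) => //; apply: leq_trans len.
    rewrite !orderE -!quotient_cycle //; case/orP: sN => sN.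
      apply: (@leq_ltn_trans (#|<[x]> / N| * #[y])%N).
        by rewrite leq_mul2l leq_quotient orbT.
      by rewrite ltn_pmul2r ?ltn_quotient.
    apply: (@leq_ltn_trans (#[x] * #|<[y]> / N|)%N).
      by rewrite leq_mul2r leq_quotient orbT.
    by rewrite ltn_pmul2l ?ltn_quotient.
  split=> //; split; last split=> //.
    apply: coset_idr; first by rewrite groupR ?groupX.
    rewrite morphR ?groupX // morphX //.
    by apply/eqP/commgP.
  apply: coset_idr; first by rewrite groupX.
  by rewrite morphX // (tight_rotations_order_dvd rotN).
have nxN := meet_conj_norm xy2.
set N := [group of <[y]> :&: <[y]> :^ (x * y)].
have sNY : N \subset <[y]> by apply: subsetIl.
have [N1 | ntN] := eqVneq (N : {set gT}) 1; last first.
  have [|_ [cN _]] := quo N nxN (nyY _ sNY) (ntY _ sNY) ntN; first by rewrite sNY orbT.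
  have yY : y ^+ 2 \in <[y]> by rewrite mem_cycle.
  have dxY : (y ^+ 2) ^ x \in <[y]>.
    by rewrite conjg_mulR groupM // (subsetP sNY).
  (* Conjugates have equal order, and a cyclic group has one subgroup of each order; hence [x]
     normalises [<[y ^+ 2]>]. *)
  have eqd : <[(y ^+ 2) ^ x]> = <[y ^+ 2]>.
    apply/eqP; rewrite (eq_subG_cyclic (cycle_cyclic y)) ?cycle_subG //.
    by rewrite -!orderE orderJ.
  have cY u : u \in <[y]> -> u ^ y = u.
    by case/cycleP=> i ->; apply/conjg_fixP/commgP; exact/commute_sym/commuteX.
  apply: odd_commute_sqr ox _; apply/commgP/conjg_fixP.
  have dd : (y ^+ 2) ^ x \in <[y ^+ 2]> by rewrite -eqd cycle_id.
  have ddx : ((y ^+ 2) ^ x) ^ x \in <[y]>.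
    by case/cycleP: dd => i {1}->; rewrite conjXg groupX.
  (* Conjugation by [y] is trivial on [<[y]>], which contains both conjugates, so [x ^+ 2] acts on
     [y ^+ 2] as [(x * y) ^+ 2 = 1] does. *)
  rewrite expg2 conjgM -[RHS]conjg1 -xy2 expg2 !conjgM.
  by rewrite (cY _ dxY) (cY _ ddx).
have nyM : y \in 'N(<[x]> :&: <[x]> :^ (y^-1 * x^-1)).
  have [_ _ + _ _] := tight_rotationsC rot.
  by move/meet_conj_norm; rewrite groupV cycleV.
set M := [group of <[x]> :&: <[x]> :^ (y^-1 * x^-1)].
have sMX : M \subset <[x]> by apply: subsetIl.
have [M1 | ntM] := eqVneq (M : {set gT}) 1; last first.
  have [|rotM [cM [dM oM]]] := quo M (nxX _ sMX) nyM (ntX _ sMX) ntM; first by rewrite sMX.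
  have xy2X : x ^ (y ^+ 2) \in <[x]>.
    have := subsetP sMX _ cM.
    by rewrite commgEr conjVg groupMr ?cycle_id // groupV.
  (* Being a power of [x], the element [x ^ (y ^+ 2)] is inverted by [t]; since [t] inverts both [x]
     and [y], its conjugate by [t] is also the inverse of [x ^ (y ^- 2)]. *)
  have xy2V : x ^ (y ^- 2) = x ^ (y ^+ 2).
    have : (x ^ (y ^+ 2)) ^ t = (x ^ (y ^+ 2))^-1.
      by case/cycleP: xy2X => i ->; rewrite conjXg xt expgVn.
    by rewrite conjJg xt conjXg yt conjVg expgVn => /invg_inj.
  have y4 : commute (y ^+ 4) x.
    apply/commute_sym/commgP/conjg_fixP.
    by rewrite -[4]/(2 + 2)%N expgD conjgM -xy2V conjgKV.
  (* [y ^+ 4] commutes with [x] and [y], so conjugation by [x * y] fixes it and it lies in [N],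
     which is trivial in this branch. *)
  have {}y4 : y ^+ 4 = 1.
    apply/set1gP; rewrite -N1 inE mem_cycle /= mem_conjg.
    suff -> : (y ^+ 4) ^ (x * y)^-1 = y ^+ 4 by rewrite mem_cycle.
    apply/conjg_fixP/commgP/commuteV/commuteM => //.
    exact/commute_sym/commuteX.
  (* This power lies in [M], hence in both cyclic factors. The order of [y] then divides 4 and twice
     an odd number, so it divides 2. *)
  have yd : y ^+ (2 * #[coset M x]) = 1.
    by apply/set1gP; rewrite -tiXY inE (subsetP sMX) ?mem_cycle.
  suff -> : y ^+ 2 = 1 by apply/commute_sym/commute1.
  have y2 : #[y] %| gcdn (2 * 2) (2 * #[coset M x]).
    by rewrite dvdn_gcd !order_dvdn y4 yd eqxx.
  apply/eqP; rewrite -order_dvdn; move: y2; rewrite -muln_gcdr.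
  by have /eqP -> : coprime 2 #[coset M x] by rewrite coprime2n.
(* As [N = 1], the product of [<[y]>] and its conjugate has [#[y] ^ 2] elements, inside a group of
   order [#[x] * #[y]]. The next bound is the same argument with [M = 1]. *)
have leYX : #|<[y]>| <= #|<[x]>|.
  rewrite -(leq_pmul2r (cardG_gt0 <[y]>)) -(TI_cardMg tiXY).
  rewrite -{1}(cardJg <[y]> (x * y)) mulnC -(TI_cardMg N1) -(comm_joingE cXY).
  apply/subset_leq_card/mul_subG; first exact: joing_subr.
  by rewrite conj_subG ?joing_subr // groupM ?mem_gen // inE cycle_id ?orbT.
have leXY : #|<[x]>| <= #|<[y]>|.
  rewrite -(leq_pmul2l (cardG_gt0 <[x]>)) -(TI_cardMg tiXY).
  rewrite -{2}(cardJg <[x]> (y^-1 * x^-1)) -(TI_cardMg M1) -(comm_joingE cXY).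
  apply/subset_leq_card/mul_subG; first exact: joing_subl.
  by rewrite conj_subG ?joing_subl // groupM ?groupV ?mem_gen // inE cycle_id ?orbT.
have oG : odd #|<[x]> <*> <[y]>|.
  have e : #|<[x]>| = #|<[y]>| by apply/eqP; rewrite eqn_leq leXY.
  by rewrite comm_joingE // (TI_cardMg tiXY) -e oddM andbb.
have xy1 : x * y = 1.
  have G_xy : x * y \in <[x]> <*> <[y]> by rewrite groupM ?mem_gen // inE cycle_id ?orbT.
  have /eqP cop : coprime 2 #|<[x]> <*> <[y]>| by rewrite coprime2n.
  apply/eqP; rewrite -[x * y]expg1 -order_dvdn -cop dvdn_gcd order_dvdG // andbT.
  by rewrite order_dvdn xy2.
suff -> : y = 1 by rewrite expg1n; apply/commute_sym/commute1.
apply/set1gP; rewrite -tiXY inE cycle_id andbT.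
by rewrite -(mulKg x y) xy1 mulg1 groupV cycle_id.
Qed.
End TightGroup.

(** * Flags, sections and reflections *)

Section PolyhedronFlags.
Local Open Scope order_scope.
Variables (d : Order.disp_t) (P : finTBPOrderType d) (rk : P -> int).

(** A flag is handled through its three proper faces; strict monotonicity of [rk] then forces their
    ranks to be 0, 1 and 2. *)
Definition is_flag (v e F : P) : bool := [&& \bot < v, v < e, e < F & F < \top].

Definition mkflag (v e F : P) : {set P} := [set \bot; v; e; F; \top].

Hypothesis rk_lt : {homo rk : x y / x < y}.
Hypothesis rk_codom : forall i : int, (i \in codom rk) = (- 1 <= i <= 3)%R.

(* The literals are cast from [nat] because [lia] does not see through the
   coercion paths of [3 : int] in [is_polyhedron]. *)
Lemma rank_bounds x : (- Posz 1 <= rk x <= Posz 3)%R.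
Proof. by have := rk_codom (rk x); rewrite codom_f => /esym. Qed.

Lemma rank_bot : rk \bot = (- Posz 1)%R.
Proof.
have /codomP[x rx] : (- Posz 1)%R \in codom rk by rewrite rk_codom.
have := rank_bounds \bot; have := le0x x.
by rewrite le_eqVlt => /orP[/eqP->|/rk_lt]; rewrite -rx //; lia.
Qed.

Lemma rank_top : rk \top = Posz 3.
Proof.
have /codomP[x rx] : Posz 3 \in codom rk by rewrite rk_codom.
have := rank_bounds \top; have := lex1 x.
by rewrite le_eqVlt => /orP[/eqP<-|/rk_lt]; rewrite -rx //; move: (rk \top); lia.
Qed.

Lemma flag_ranks v e F : is_flag v e F -> [/\ rk v = Posz 0, rk e = Posz 1 & rk F = Posz 2].
Proof.
case/and4P=> /rk_lt; rewrite rank_bot => h1 /rk_lt h2 /rk_lt h3 /rk_lt.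
by rewrite rank_top => h4; split; lia.
Qed.

Lemma lt_rank x y : x >=< y -> (rk x < rk y)%R -> x < y.
Proof.
case: comparableP => // [/rk_lt + _ | -> _]; lia.
Qed.

Lemma is_flagE v e F : is_flag v e F = [&& v < e, e < F, rk v == Posz 0 & rk F == Posz 2].
Proof.
apply/idP/and4P=> [f|[ve eF /eqP rv /eqP rF]].
  have [-> _ ->] := flag_ranks f; case/and4P: f => *; split; by [].
rewrite /is_flag ve eF !lt_neqAle le0x lex1 !andbT; apply/andP; split.
  by apply/eqP=> v0; move: rv; rewrite -v0 rank_bot.
by apply/eqP=> v0; move: rF; rewrite v0 rank_top.
Qed.

Lemma mkflag_chain v e F : is_flag v e F -> is_chain (mkflag v e F).
Proof.
case/and4P=> h1 h2 h3 h4.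
have l1 := ltW (lt_trans h2 h3); have [k2 k3] := (ltW h2, ltW h3).
apply/forall_inP=> x; rewrite !inE => xA; apply/forall_inP=> y; rewrite !inE.
by case/orP=> [/orP[/orP[/orP[]|]|]|] /eqP->; rewrite ?le0x ?lex1 //;
  case/orP: xA => [/orP[/orP[/orP[]|]|]|] /eqP->;
  rewrite /Order.comparable ?le0x ?lex1 ?lexx ?k2 ?k3 ?l1 ?orbT.
Qed.

(** Maximality: the five faces cover all ranks, and a face comparable with another of the same rank
    equals it. *)
Lemma mkflag_flags v e F : is_flag v e F -> mkflag v e F \in flags P.
Proof.
move=> f; rewrite inE; apply/maxsetP; split; first exact: mkflag_chain.
move=> A /forall_inP cA sA; apply/eqP; rewrite eq_sym eqEsubset sA /=.
apply/subsetP=> z zA; have [rv re rF] := flag_ranks f.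
have same w : w \in mkflag v e F -> rk z = rk w -> z \in mkflag v e F.
  move=> wA rzw; have := forall_inP (cA z zA) w (subsetP sA _ wA).
  by case: comparableP => // [/rk_lt|/rk_lt|->] //; rewrite rzw ltxx.
have := rank_bounds z => rz.
have [] : [\/ rk z = (- Posz 1)%R, rk z = Posz 0, rk z = Posz 1 | rk z = Posz 2 \/ rk z = Posz 3].
  have [?|?] := eqVneq (rk z) (- Posz 1)%R; first by constructor 1.
  have [?|?] := eqVneq (rk z) (Posz 0); first by constructor 2.
  have [?|?] := eqVneq (rk z) (Posz 1); first by constructor 3.
  by constructor 4; lia.
- by move=> r; apply: (same \bot); rewrite ?rank_bot // !inE eqxx.
- by move=> r; apply: (same v); rewrite ?rv // !inE eqxx ?orbT.
- by move=> r; apply: (same e); rewrite ?re // !inE eqxx ?orbT.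
case=> r; first by apply: (same F); rewrite ?rF // !inE eqxx ?orbT.
by apply: (same \top); rewrite ?rank_top // !inE eqxx ?orbT.
Qed.

Lemma mkflag_inj v e F v' e' F' : is_flag v e F -> is_flag v' e' F' ->
  mkflag v e F = mkflag v' e' F' -> [/\ v = v', e = e' & F = F'].
Proof.
move=> f f' E; have [rv re rF] := flag_ranks f; have [rv' re' rF'] := flag_ranks f'.
have [] : [/\ v \in mkflag v' e' F', e \in mkflag v' e' F' & F \in mkflag v' e' F'].
  by rewrite -E !inE !eqxx !orbT.
rewrite !inE => hv he hF; split.
- by case/orP: hv => [/orP[/orP[/orP[]|]|]|] /eqP h //; move: rv;
    rewrite h ?rank_bot ?rank_top ?re' ?rF'.
- by case/orP: he => [/orP[/orP[/orP[]|]|]|] /eqP h //; move: re;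
    rewrite h ?rank_bot ?rank_top ?rv' ?rF'.
- by case/orP: hF => [/orP[/orP[/orP[]|]|]|] /eqP h //; move: rF;
    rewrite h ?rank_bot ?rank_top ?re' ?rv'.
Qed.

Hypothesis card_flag : forall A, A \in flags P -> #|A| = 5%N.

(** The rank is injective on a chain, so a chain of five faces realises each of the five ranks
    exactly once. *)
Lemma flagsP A : A \in flags P -> exists v e F, is_flag v e F /\ A = mkflag v e F.
Proof.
move=> fA; have := fA; rewrite inE => /maxsetP[/forall_inP cA _].
have cmp x y : x \in A -> y \in A -> x >=< y.
  by move=> xA; apply: (forall_inP (cA x xA)).
(* The shift turns the ranks -1 to 3 into 0 to 4, so [inord] never falls back on its default
   value. *)
pose r x : 'I_5 := inord `|(rk x + Posz 1)%R|.
have rE x : nat_of_ord (r x) = `|(rk x + Posz 1)%R|%N.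
  by rewrite inordK //; have := rank_bounds x; lia.
have inj : {in A &, injective r}.
  move=> x y xA yA /(congr1 val) /=; rewrite !rE => rxy.
  have := cmp x y xA yA; have := rank_bounds x; have := rank_bounds y.
  by case: comparableP => // /rk_lt; lia.
have full : r @: A = setT.
  by apply/eqP; rewrite eqEcard subsetT cardsT card_ord card_in_imset // card_flag.
have ex (i : nat) : i < 5 -> exists2 x, x \in A & rk x = (Posz i - Posz 1)%R.
  move=> i5; have : Ordinal i5 \in r @: A by rewrite full.
  case/imsetP=> x xA /(congr1 val) /=; rewrite rE => rx; exists x => //.
  by have := rank_bounds x; lia.
have [v vA rv] := ex 1%N isT; have [e eA re] := ex 2%N isT; have [F FA rF] := ex 3%N isT.
have f : is_flag v e F.
  by rewrite is_flagE rv rF !lt_rank ?rv ?re ?rF // cmp.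
exists v, e, F; split=> //; apply/eqP; rewrite eq_sym eqEcard.
rewrite (card_flag fA) (card_flag (mkflag_flags f)) leqnn andbT.
have [a aA ra] := ex 0%N isT; have [b bA rb] := ex 4%N isT.
have ea : a = \bot.
  apply/eqP; apply: contraT => na.
  have /rk_lt : \bot < a by rewrite lt_neqAle le0x eq_sym na.
  by rewrite rank_bot ra.
have eb : b = \top.
  apply/eqP; apply: contraT => nb.
  have /rk_lt : b < \top by rewrite lt_neqAle lex1 nb.
  by rewrite rank_top rb.
by apply/subsetP=> x; rewrite !inE -ea -eb => /orP[/orP[/orP[/orP[]|]|]|] /eqP->.
Qed.

End PolyhedronFlags.

(** * Polygonal sections: walking around them and counting their incident pairs *)

Section Polygon.
Local Open Scope order_scope.
Variables (d : Order.disp_t) (P : finTBPOrderType d) (n : nat) (lo hi : P).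
Hypothesis polygon : is_polygon n lo hi.

Lemma polygon_pair : exists f : 'I_n + 'I_n -> P,
  [/\ injective f,
      forall i j, [&& lo < f (inl i), f (inl i) < f (inr j) & f (inr j) < hi]
                  = (i == j) || (i == ordS j)
    & forall a b, lo < a -> a < b -> b < hi ->
        exists i j, a = f (inl i) /\ b = f (inr j)].
Proof.
have [f [injf monof codf]] := polygon.
have sec u : lo < f u < hi by have := codom_f f u; rewrite codf inE.
exists f; split=> // [i j|a b la ab bh].
  have /andP[-> _] := sec (inl i); have /andP[_ ->] := sec (inr j).
  by rewrite lt_neqAle (inj_eq injf) monof andbT.
have : b \in codom f by rewrite codf inE bh (lt_trans la ab).
have : a \in codom f by rewrite codf inE la (lt_trans ab bh).
case/codomP=> u eu /codomP[w ew]; move: ab; rewrite eu ew lt_neqAle (inj_eq injf) monof.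
case: u w {eu ew} => [i|i] [j|j] //=.
- by rewrite (inj_eq inl_inj) => /andP[/negPf->].
- by move=> _; exists i, j.
- by rewrite (inj_eq inr_inj) => /andP[/negPf->].
Qed.

Lemma iter_ordS m k (i : 'I_m) : val (iter k (@ordS m) i) = (i + k) %% m.
Proof.
elim: k => [|k IHk] /=; first by rewrite addn0 modn_small.
by rewrite IHk -addn1 modnDml addn1 addnS.
Qed.

Lemma ordS_ind m (R : 'I_m -> Prop) : (forall i, R i -> R (ordS i)) ->
  forall i j, R i -> R j.
Proof.
(* Going [m - i] steps leads from [i] to 0 modulo [m], and [j] more lead to [j], whichever of the
   two is larger. *)
move=> step i j Ri; suff <- : iter (j + (m - i)) (@ordS m) i = j.
  by elim: (j + _)%N => //= k; apply: step.
apply: val_inj; rewrite iter_ordS addnCA subnKC ?(ltnW (ltn_ord i)) //.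
by rewrite modnDr modn_small.
Qed.

(** The incident pairs of a polygon form one cycle in which neighbours differ in a single member, so
    a property passed on by such changes reaches every pair. *)
Lemma polygon_ind (Q : P -> P -> Prop) :
    (forall a a' b, lo < a -> lo < a' -> a < b -> a' < b -> b < hi -> Q a b -> Q a' b) ->
    (forall a b b', lo < a -> a < b -> a < b' -> b < hi -> b' < hi -> Q a b -> Q a b') ->
  forall a b a' b', lo < a -> a < b -> b < hi -> lo < a' -> a' < b' -> b' < hi ->
  Q a b -> Q a' b'.
Proof.
move=> Qv Qe a b a' b'; have [f [injf fE fP]] := polygon_pair.
pose R i := Q (f (inl i)) (f (inr i)).
have f0 i : [&& lo < f (inl i), f (inl i) < f (inr i) & f (inr i) < hi].
  by rewrite fE eqxx.
have f1 i : [&& lo < f (inl (ordS i)), f (inl (ordS i)) < f (inr i) & f (inr i) < hi].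
  by rewrite fE eqxx orbT.
have R1 i : R i -> Q (f (inl (ordS i))) (f (inr i)).
  have /and3P[? ? ?] := f0 i; have /and3P[? ? ?] := f1 i; exact: Qv.
have R1' i : Q (f (inl (ordS i))) (f (inr i)) -> R i.
  have /and3P[? ? ?] := f0 i; have /and3P[? ? ?] := f1 i; exact: Qv.
have step i : R i -> R (ordS i).
  move/R1; have /and3P[? ? ?] := f0 (ordS i); have /and3P[? ? ?] := f1 i; exact: Qe.
have all_R i j : R i -> R j by apply: (@ordS_ind n R step).
move=> la ab bh la' ab' bh'.
have [i [j [ea eb]]] := fP _ _ la ab bh; have [i' [j' [ea' eb']]] := fP _ _ la' ab' bh'.
have := fE i j; rewrite -ea -eb la ab bh => /esym/orP[] /eqP ij;
have := fE i' j'; rewrite -ea' -eb' la' ab' bh' => /esym/orP[] /eqP ij';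
rewrite ea eb ea' eb' ij ij'.
- exact: (all_R j j').
- by move/(all_R j j')/R1.
- by move/R1'/(all_R j j').
- by move/R1'/(all_R j j')/R1.
Qed.

Lemma neq_ordS (i : 'I_n) : (1 < n)%N -> i != ordS i.
Proof.
move=> n1; apply/eqP=> /(congr1 val) /= e; have := ltn_ord i.
rewrite leq_eqVlt => /orP[/eqP h|h]; move: e; last by rewrite modn_small //; lia.
by rewrite h modnn; lia.
Qed.

Lemma card_polygon_pairs : (1 < n)%N ->
  #|[set u : P * P | [&& lo < u.1, u.1 < u.2 & u.2 < hi]]| = (2 * n)%N.
Proof.
move=> n1; have [f [injf fE fP]] := polygon_pair.
(* Each edge comes with a choice of one of its two ends, distinct because [1 < n]. Counting edge-end
   pairs also covers the digon, whose two edges share both ends. *)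
pose g (u : 'I_n * bool) := (f (inl (if u.2 then ordS u.1 else u.1)), f (inr u.1)).
have injg : injective g.
  move=> [i x] [j y] [/injf[+] /injf[ij]]; rewrite -ij.
  by case: x y => [] [] //= /eqP; rewrite ?(eq_sym (ordS i)) (negPf (neq_ordS i n1)).
have -> : [set u : P * P | [&& lo < u.1, u.1 < u.2 & u.2 < hi]] = [set g u | u in setT].
  apply/setP=> [[a b]]; rewrite inE /=; apply/and3P/imsetP=> [[la ab bh]|].
    have [i [j [ea eb]]] := fP _ _ la ab bh; have := fE i j.
    rewrite -ea -eb la ab bh => /esym/orP[] /eqP ij.
      by exists (j, false); rewrite ?inE // /g /= -ij ea eb ij.
    by exists (j, true); rewrite ?inE // /g /= -ij ea eb.
  by case=> [[i x] _ [-> ->]]; apply/and3P; rewrite fE; case: x; rewrite /= eqxx ?orbT.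
by rewrite card_imset // cardsT card_prod card_ord card_bool mulnC.
Qed.

End Polygon.

(** The dihedral group: [s] inverts [x = r * s], so the whole group is [<[x]> * <[s]>]. Were [s] a
    power of [x], it would commute with [x], forcing [x ^+ 2 = 1] and a group of order at most 2. *)
Lemma involutions_rotation (gT : finGroupType) (r s : gT) n :
  (r * r = 1)%g -> (s * s = 1)%g -> #|<<[set r; s]>>%g| = (2 * n)%N -> 1 < n ->
  #[r * s]%g = n /\ s \notin <[r * s]>%g.
Proof.
move=> r2 s2 cD n1; set x := (r * s)%g; set D := <<_>>%g in cD *.
have sV : (s^-1 = s)%g by apply/eqP; rewrite eq_invg_mul s2.
have xs : (x ^ s = x^-1)%g.
  have rV : (r^-1 = r)%g by apply/eqP; rewrite eq_invg_mul r2.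
  by rewrite conjgE invMg sV rV !mulgA -mulgA s2 mulg1.
have rD : r \in D by rewrite mem_gen // !inE eqxx.
have sD : s \in D by rewrite mem_gen // !inE eqxx orbT.
have xD : <[x]>%g \subset D by rewrite cycle_subG groupM.
have nsx : <[s]>%g \subset 'N(<[x]>)%g by rewrite norms_cycle xs groupV cycle_id.
have eD : D = (<[x]> * <[s]>)%g.
  rewrite -norm_joinEr //; apply/eqP; rewrite eqEsubset gen_subG join_subG xD cycle_subG sD.
  rewrite subUset !sub1set; have sJ : s \in (<[x]> <*> <[s]>)%g.
    by rewrite mem_gen // inE cycle_id orbT.
  rewrite sJ !andbT -(groupMr _ sJ) mem_gen // inE cycle_id //.
have os : #[s]%g <= 2 by rewrite dvdn_leq // order_dvdn expgS expg1 s2.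
have leD : #|D| <= #[x]%g * 2.
  by rewrite eD (leq_trans (dvdn_leq _ (dvdn_cardMg _ _))) ?muln_gt0 ?cardG_gt0 // leq_mul2l os orbT.
have sx : s \notin <[x]>%g.
  apply/negP=> sx; have sDx : D \subset <[x]>%g.
    by rewrite eD mul_subG // cycle_subG.
  have xx : (x ^+ 2 == 1)%g.
    rewrite expgS expg1 -eq_invg_mul -xs.
    by case/cycleP: sx => i ->; apply/eqP/conjg_fixP/commgP/commuteX.
  move: xx; rewrite -order_dvdn => /dvdn_leq -/(_ isT).
  by have := subset_leq_card sDx; rewrite cD -orderE; lia.
split=> //; apply/eqP; rewrite eqn_leq; apply/andP; split; last by move: leD; rewrite cD; lia.
have : #|D : <[x]>|%g != 1%N.
  by apply: contra sx => /eqP/(index1g xD) ->.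
have := Lagrange xD; rewrite cD -orderE.
have := indexg_gt0 [group of D] <[x]>%g.
by case: #|_ : _|%g => [|[|k]] // _ e _; rewrite -(leq_pmul2l (isT : 0 < 2)) -e mulnC leq_mul2l orbT.
Qed.

(** * Flag-connectedness and the free action of the automorphisms *)

Section Polyhedron.
Local Open Scope order_scope.
Variables (d : Order.disp_t) (P : finTBPOrderType d) (rk : P -> int) (p q : nat).
Hypotheses (polyP : is_polyhedron rk) (typeP : has_type rk p q).

Let rk_lt : {homo rk : x y / x < y}. Proof. by case: polyP. Qed.
Let rk_codom : forall i : int, (i \in codom rk) = (- 1 <= i <= 3)%R.
Proof. by case: polyP. Qed.
Let card_flag : forall A, A \in flags P -> #|A| = 5%N. Proof. by case: polyP. Qed.

Lemma face_polygon v e F : is_flag v e F -> is_polygon p (\bot : P) F.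
Proof.
by move=> f; have [_ _ rF] := flag_ranks rk_lt rk_codom f; case: typeP => + _; apply.
Qed.

Lemma vertex_polygon v e F : is_flag v e F -> is_polygon q v (\top : P).
Proof.
by move=> f; have [rv _ _] := flag_ranks rk_lt rk_codom f; case: typeP => _; apply.
Qed.

Lemma is_flagI (v e F : P) : \bot < v -> v < e -> e < F -> F < \top -> is_flag v e F.
Proof. by rewrite /is_flag => -> -> -> ->. Qed.

Lemma mem_mkflag_rank v e F z : is_flag v e F -> z \in mkflag v e F ->
  [/\ rk z = Posz 0 -> z = v, rk z = Posz 1 -> z = e & rk z = Posz 2 -> z = F].
Proof.
move=> f; have [rv re rF] := flag_ranks rk_lt rk_codom f.
have rb := rank_bot rk_lt rk_codom; have rt := rank_top rk_lt rk_codom.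
rewrite !inE => /orP[/orP[/orP[/orP[]|]|]|] /eqP->; split=> //;
by rewrite ?rb ?rt ?rv ?re ?rF.
Qed.

Lemma proper_rank (z : P) : z \in proper_section (\bot : P) \top ->
  [\/ rk z = Posz 0, rk z = Posz 1 | rk z = Posz 2].
Proof.
rewrite inE => /andP[/rk_lt + /rk_lt].
rewrite (rank_bot rk_lt rk_codom) (rank_top rk_lt rk_codom) => h1 h2.
have [?|?] := eqVneq (rk z) (Posz 0); first by constructor 1.
have [?|?] := eqVneq (rk z) (Posz 1); first by constructor 2.
by constructor 3; lia.
Qed.

Lemma common_flag (z w : P) : z >=< w ->
  exists v e F, [/\ is_flag v e F, z \in mkflag v e F & w \in mkflag v e F].
Proof.
move=> zw; have : is_chain [set z; w].
  by apply/forall_inP=> x; rewrite !inE => /orP[]/eqP->; apply/forall_inP=> y;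
    rewrite !inE => /orP[]/eqP->; rewrite ?comparablexx // comparable_sym.
case/maxset_exists=> A mA /subsetP sA.
have : A \in flags P by rewrite inE.
case/(flagsP rk_lt rk_codom card_flag) => v [e [F [f EA]]].
by exists v, e, F; rewrite -EA !sA ?inE ?eqxx ?orbT.
Qed.

(** Flag-connectedness. Flags sharing a 2-face or a vertex are joined by walking around a polygon;
    flags sharing an edge, by changing the vertex and then moving around the new one. Connectedness
    of the whole poset joins any two vertices by a path of comparable faces. *)
Lemma flag_ind (Q : P -> P -> P -> Prop) :
    (forall v v' e F, is_flag v e F -> is_flag v' e F -> Q v e F -> Q v' e F) ->
    (forall v e e' F, is_flag v e F -> is_flag v e' F -> Q v e F -> Q v e' F) ->
    (forall v e F F', is_flag v e F -> is_flag v e F' -> Q v e F -> Q v e F') ->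
  forall v e F v' e' F', is_flag v e F -> is_flag v' e' F' -> Q v e F -> Q v' e' F'.
Proof.
move=> Q0 Q1 Q2.
have sameF v e F v' e' : is_flag v e F -> is_flag v' e' F -> Q v e F -> Q v' e' F.
  move=> f f'; case/and4P: (f) => a1 a2 a3 a4; case/and4P: (f') => b1 b2 b3 _.
  by apply: (polygon_ind (face_polygon f) (Q := fun a b => Q a b F)) => // *;
    [apply: Q0; last eassumption | apply: Q1; last eassumption]; apply: is_flagI.
have samev v e F e' F' : is_flag v e F -> is_flag v e' F' -> Q v e F -> Q v e' F'.
  move=> f f'; case/and4P: (f) => a1 a2 a3 a4; case/and4P: (f') => _ b2 b3 b4.
  by apply: (polygon_ind (vertex_polygon f) (Q := fun a b => Q v a b)) => // *;
    [apply: Q1; last eassumption | apply: Q2; last eassumption]; apply: is_flagI.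
have samee v e F v' F' : is_flag v e F -> is_flag v' e F' -> Q v e F -> Q v' e F'.
  move=> f f'; case/and4P: (f) => a1 a2 a3 a4; case/and4P: (f') => b1 b2 b3 b4.
  by move/(Q0 v v' e F f (is_flagI b1 b2 a3 a4)); apply: samev => //; apply: is_flagI.
(* [good z] asks for one flag through [z] with the property; [spread] upgrades it to every flag
   through [z], so goodness passes along a path through common flags. *)
pose good z := exists v e F, [/\ is_flag v e F, z \in mkflag v e F & Q v e F].
have spread z v e F : good z -> z \in proper_section (\bot : P) \top -> is_flag v e F ->
    z \in mkflag v e F -> Q v e F.
  case=> v' [e' [F' [f' zA' Q']]] /proper_rank rz f zA.
  have [z0 z1 z2] := mem_mkflag_rank f zA; have [z0' z1' z2'] := mem_mkflag_rank f' zA'.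
  case: rz => r.
  - by apply: (samev v e' F') => //; rewrite -(z0 r) (z0' r).
  - by apply: (samee v' e F') => //; rewrite -(z1 r) (z1' r).
  - by apply: (sameF v' e' F) => //; rewrite -(z2 r) (z2' r).
move=> v e F v' e' F' f f' Qf.
have conn : section_connected (\bot : P) \top.
  case: polyP => _ _ _ + _; apply; first exact: le0x.
  by rewrite (rank_bot rk_lt rk_codom) (rank_top rk_lt rk_codom).
have prop u w x : is_flag u w x -> u \in proper_section (\bot : P) \top.
  case/and4P=> h1 h2 h3 h4; rewrite inE h1 /=.
  exact: lt_trans h2 (lt_trans h3 h4).
have mem u w x : u \in mkflag u w x by rewrite !inE eqxx ?orbT.
apply: (@spread v' v' e' F'); [| exact: prop f' | exact: f' | exact: mem].
have /connectP[s] := conn v v' (prop _ _ _ f) (prop _ _ _ f').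
have : good v by exists v, e, F; split=> //; exact: mem.
elim: s v {f Qf} => [|w s IHs] z gz /= => [_ -> //|/andP[/and3P[pz pw zw] ps] lw].
apply: IHs ps lw; have [a [b [c [fl za wa]]]] := common_flag zw.
by exists a, b, c; split=> //; apply: spread fl za.
Qed.

Lemma aut_le (s : {perm P}) x y : s \in automorphisms P -> (s x <= s y) = (x <= y).
Proof. by rewrite inE => /forallP/(_ x)/forallP/(_ y)/eqP. Qed.

Lemma aut_lt (s : {perm P}) x y : s \in automorphisms P -> (s x < s y) = (x < y).
Proof. by move=> sA; rewrite !lt_neqAle aut_le // (inj_eq perm_inj). Qed.

Lemma aut_bot (s : {perm P}) : s \in automorphisms P -> s \bot = \bot.
Proof.
move=> sA; apply/eqP; rewrite -lex0 -[X in _ <= X](permKV s).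
by rewrite aut_le // le0x.
Qed.

Lemma aut_top (s : {perm P}) : s \in automorphisms P -> s \top = \top.
Proof.
move=> sA; apply/eqP; rewrite -le1x -[X in X <= _](permKV s).
by rewrite aut_le // lex1.
Qed.

Lemma aut_flag (s : {perm P}) v e F : s \in automorphisms P ->
  is_flag (s v) (s e) (s F) = is_flag v e F.
Proof.
move=> sA; rewrite /is_flag -[in LHS](aut_bot sA) -[in LHS](aut_top sA).
by rewrite !aut_lt.
Qed.

Lemma aut_mkflag (s : {perm P}) v e F : s \in automorphisms P ->
  s @: mkflag v e F = mkflag (s v) (s e) (s F).
Proof. by move=> sA; rewrite /mkflag !imsetU !imset_set1 (aut_bot sA) (aut_top sA). Qed.

Lemma aut_section (s : {perm P}) x y z : s \in automorphisms P -> s x = x -> s y = y ->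
  (s z \in proper_section x y) = (z \in proper_section x y).
Proof. by move=> sA sx sy; rewrite !inE -[in LHS]sx -[in LHS]sy !aut_lt. Qed.

Lemma pair_other (T : finType) (S : {set T}) a b c :
  #|S| = 2 -> a \in S -> b \in S -> c \in S -> b != a -> c != a -> b = c.
Proof.
move=> cS aS bS cS' ba ca; apply/eqP; apply: contraT => bc.
suff : [set a; b; c] \subset S.
  move/subset_leq_card; rewrite cS -setUA cardsU1 cards2 bc !inE.
  by rewrite eq_sym (negPf ba) eq_sym (negPf ca).
by rewrite !subUset !sub1set aS bS.
Qed.

Lemma flag_diamond (v e F : P) : is_flag v e F ->
  [/\ #|proper_section (\bot : P) e| = 2, #|proper_section v F| = 2 & #|proper_section e \top| = 2].
Proof.
move=> f; have [rv re rF] := flag_ranks rk_lt rk_codom f.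
have rb := rank_bot rk_lt rk_codom; have rt := rank_top rk_lt rk_codom.
case/and4P: f => h1 h2 h3 h4; case: polyP => _ _ _ _ dia.
by split; apply: dia; rewrite ?le0x ?lex1 ?(ltW (lt_trans h2 h3)) ?rb ?rt ?rv ?re ?rF.
Qed.

Lemma flag_sections (v e F : P) : is_flag v e F ->
  [/\ v \in proper_section (\bot : P) e, e \in proper_section v F & F \in proper_section e \top].
Proof. by case/and4P=> h1 h2 h3 h4; rewrite !inE h1 h2 h3 h4. Qed.

(* An automorphism fixing one end of a diamond and one of its two middle faces
   fixes the other. *)
Lemma aut_other (s : {perm P}) x y a b : s \in automorphisms P -> s x = x -> s y = y ->
  #|proper_section x y| = 2 -> a \in proper_section x y -> b \in proper_section x y ->
  s a = a -> s b = b.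
Proof.
move=> sA sx sy card2 aS bS sa; have [->//|ba] := eqVneq b a.
apply: (pair_other card2 aS _ bS _ ba); first by rewrite (aut_section _ sA sx sy).
by rewrite -sa (inj_eq perm_inj).
Qed.

(** By the diamond condition, an automorphism fixing a flag fixes each adjacent flag, hence by
    connectedness all flags and all faces. *)
Lemma aut_free s v e F : s \in automorphisms P -> is_flag v e F ->
  s v = v -> s e = e -> s F = F -> s = 1%g.
Proof.
move=> sA f sv se sF; have s0 := aut_bot sA; have s1 := aut_top sA.
have fix_flag v' e' F' : is_flag v' e' F' -> [/\ s v' = v', s e' = e' & s F' = F'].
  move=> f'; apply: (flag_ind (Q := fun a b c => [/\ s a = a, s b = b & s c = c]) _ _ _ f f') => //.
  - move=> a a' b c g g' [sa sb sc]; split=> //.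
    have [d0 _ _] := flag_diamond g; have [m _ _] := flag_sections g.
    have [m' _ _] := flag_sections g'; exact: aut_other m m' sa.
  - move=> a b b' c g g' [sa sb sc]; split=> //.
    have [_ d0 _] := flag_diamond g; have [_ m _] := flag_sections g.
    have [_ m' _] := flag_sections g'; exact: aut_other m m' sb.
  - move=> a b c c' g g' [sa sb sc]; split=> //.
    have [_ _ d0] := flag_diamond g; have [_ _ m] := flag_sections g.
    have [_ _ m'] := flag_sections g'; exact: aut_other m m' sc.
apply/permP=> z; rewrite perm1.
have [v' [e' [F' [/fix_flag[? ? ?] + _]]]] := common_flag (comparablexx z).
by rewrite !inE => /orP[/orP[/orP[/orP[]|]|]|] /eqP->.
Qed.

(** Translates adjacency, which compares whole chains outside one rank, into conditions on the three
    proper faces. The two lemmas that follow do so for the other ranks. *)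
Lemma adjacent0 (v e F v' e' F' : P) : is_flag v e F -> is_flag v' e' F' ->
  adjacent rk 0 (mkflag v e F) (mkflag v' e' F') <-> [/\ v' <> v, e' = e & F' = F].
Proof.
move=> f f'; have [rv re rF] := flag_ranks rk_lt rk_codom f.
have [rv' re' rF'] := flag_ranks rk_lt rk_codom f'; split=> [/andP[/eqP AB /eqP eAB]|[vv ee FF]].
  have same z : z \in mkflag v' e' F' -> rk z != 0%R -> z \in mkflag v e F.
    by move=> zB rz; move/setP/(_ z): eAB; rewrite inE rz andbT [in RHS]inE zB rz => ->.
  have ee : e' = e.
    have /(mem_mkflag_rank f)[_ + _] : e' \in mkflag v e F by apply: same; rewrite ?re' ?inE ?eqxx ?orbT.
    exact.
  have FF : F' = F.
    have /(mem_mkflag_rank f)[_ _] : F' \in mkflag v e F by apply: same; rewrite ?rF' ?inE ?eqxx ?orbT.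
    exact.
  by split=> // vv; apply: AB; rewrite vv ee FF.
apply/andP; split; first by apply/eqP=> /(mkflag_inj rk_lt rk_codom f f')[/esym].
rewrite ee FF; apply/eqP/setP=> z; rewrite !inE.
have [->|_] := eqVneq z v; first by rewrite rv !andbF.
by have [->|_] := eqVneq z v'; rewrite ?rv' ?andbF.
Qed.

Lemma adjacent1 (v e F v' e' F' : P) : is_flag v e F -> is_flag v' e' F' ->
  adjacent rk 1 (mkflag v e F) (mkflag v' e' F') <-> [/\ v' = v, e' <> e & F' = F].
Proof.
move=> f f'; have [rv re rF] := flag_ranks rk_lt rk_codom f.
have [rv' re' rF'] := flag_ranks rk_lt rk_codom f'; split=> [/andP[/eqP AB /eqP eAB]|[vv ee FF]].
  have same z : z \in mkflag v' e' F' -> rk z != 1%R -> z \in mkflag v e F.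
    by move=> zB rz; move/setP/(_ z): eAB; rewrite inE rz andbT [in RHS]inE zB rz => ->.
  have vv : v' = v.
    have /(mem_mkflag_rank f)[+ _ _] : v' \in mkflag v e F by apply: same; rewrite ?rv' ?inE ?eqxx ?orbT.
    exact.
  have FF : F' = F.
    have /(mem_mkflag_rank f)[_ _] : F' \in mkflag v e F by apply: same; rewrite ?rF' ?inE ?eqxx ?orbT.
    exact.
  by split=> // ee; apply: AB; rewrite vv ee FF.
apply/andP; split; first by apply/eqP=> /(mkflag_inj rk_lt rk_codom f f')[_ /esym].
rewrite vv FF; apply/eqP/setP=> z; rewrite !inE.
have [->|_] := eqVneq z e; first by rewrite re !andbF.
by have [->|_] := eqVneq z e'; rewrite ?re' ?andbF.
Qed.

Lemma adjacent2 (v e F v' e' F' : P) : is_flag v e F -> is_flag v' e' F' ->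
  adjacent rk 2 (mkflag v e F) (mkflag v' e' F') <-> [/\ v' = v, e' = e & F' <> F].
Proof.
move=> f f'; have [rv re rF] := flag_ranks rk_lt rk_codom f.
have [rv' re' rF'] := flag_ranks rk_lt rk_codom f'; split=> [/andP[/eqP AB /eqP eAB]|[vv ee FF]].
  have same z : z \in mkflag v' e' F' -> rk z != 2%R -> z \in mkflag v e F.
    by move=> zB rz; move/setP/(_ z): eAB; rewrite inE rz andbT [in RHS]inE zB rz => ->.
  have vv : v' = v.
    have /(mem_mkflag_rank f)[+ _ _] : v' \in mkflag v e F by apply: same; rewrite ?rv' ?inE ?eqxx ?orbT.
    exact.
  have ee : e' = e.
    have /(mem_mkflag_rank f)[_ + _] : e' \in mkflag v e F by apply: same; rewrite ?re' ?inE ?eqxx ?orbT.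
    exact.
  by split=> // FF; apply: AB; rewrite vv ee FF.
apply/andP; split; first by apply/eqP=> /(mkflag_inj rk_lt rk_codom f f')[_ _ /esym].
rewrite vv ee; apply/eqP/setP=> z; rewrite !inE.
have [->|_] := eqVneq z F; first by rewrite rF !andbF.
by have [->|_] := eqVneq z F'; rewrite ?rF' ?andbF.
Qed.

Lemma gen_fixed (T : finType) (A : {set {perm T}}) x :
  (forall g, g \in A -> g x = x) -> forall g, g \in <<A>>%g -> g x = x.
Proof.
move=> fixA g; have sA : <<A>>%g \subset 'C[x | 'P]%g.
  by rewrite gen_subG; apply/subsetP=> h /fixA hx; apply/astab1P.
by move/(subsetP sA)/astab1P.
Qed.

(** The group generated by [r] and [s] acts simply transitively on the [2 * n] incident pairs of the
    polygon, so it has order [2 * n] and the dihedral computation applies. *)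
Lemma polygon_rotation n (lo hi a b : P) (r s : {perm P}) :
    is_polygon n lo hi -> (1 < n)%N -> [/\ lo < a, a < b & b < hi] ->
    [/\ r \in automorphisms P, r lo = lo, r hi = hi, r a <> a & r b = b] ->
    [/\ s \in automorphisms P, s lo = lo, s hi = hi, s a = a & s b <> b] ->
    (r * r = 1)%g -> (s * s = 1)%g ->
    (forall g, g \in automorphisms P -> g lo = lo -> g hi = hi -> g a = a ->
       g b = b -> g = 1%g) ->
    (forall a' b', lo < a' -> a' < b' -> b' < hi ->
       #|proper_section lo b'| = 2 /\ #|proper_section a' hi| = 2) ->
  #[r * s]%g = n /\ s \notin <[r * s]>%g.
Proof.
move=> pol n1 [la ab bh] [rA rl rh ra rb] [sA sl sh sa sb] r2 s2 free dia.
apply: involutions_rotation => //; set D := <<_>>%g.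
have inD g : g \in D -> [/\ g \in automorphisms P, g lo = lo & g hi = hi].
  move=> gD; split.
  - have /subsetP/(_ _ gD) // : D \subset automorphisms P.
    by rewrite /D gen_subG subUset !sub1set rA.
  - by apply: gen_fixed gD => h; rewrite !inE => /orP[]/eqP->.
  - by apply: gen_fixed gD => h; rewrite !inE => /orP[]/eqP->.
have rD : r \in D by rewrite mem_gen // !inE eqxx.
have sD : s \in D by rewrite mem_gen // !inE eqxx orbT.
rewrite -(card_polygon_pairs pol n1).
pose phi (g : {perm P}) := (g a, g b).
have <- : phi @: D = [set u : P * P | [&& lo < u.1, u.1 < u.2 & u.2 < hi]].
  apply/setP=> [[a' b']]; rewrite inE /=; apply/imsetP/and3P.
    case=> g /inD[gA gl gh] [-> ->].
    by split; [rewrite -gl aut_lt | rewrite aut_lt | rewrite -gh aut_lt].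
  case=> la' ab' bh'.
  suff [g gD [ea eb]] : exists2 g, g \in D & g a = a' /\ g b = b'.
    by exists g => //; rewrite /phi ea eb.
  apply: (polygon_ind pol (Q := fun a' b' => exists2 g, g \in D & g a = a' /\ g b = b')
    _ _ la ab bh la' ab' bh'); last by exists 1%g; rewrite ?group1 ?perm1.
  - move=> x x' y lx lx' xy xy' yh [g gD [gx gy]].
    have [<-|ne] := eqVneq x x'; first by exists g.
    (* Products apply the left factor first: [r] moves [a] and keeps [b], then [g] carries the
       result to the other middle face of the diamond below [y]. *)
    exists (r * g)%g; rewrite ?groupM // !permM rb; split=> //.
    have [gA gl gh] := inD _ gD; have [c2 _] := dia _ _ lx xy yh.
    apply: (pair_other (a := x) c2).
    + by rewrite !inE lx xy.
    + rewrite inE; apply/andP; split; first by rewrite -gl aut_lt // -rl aut_lt.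
      by rewrite -gy aut_lt // -rb aut_lt.
    + by rewrite !inE lx' xy'.
    + by rewrite -gx (inj_eq perm_inj); apply/eqP.
    + by rewrite eq_sym.
  - move=> x y y' lx xy xy' yh yh' [g gD [gx gy]].
    have [<-|ne] := eqVneq y y'; first by exists g.
    exists (s * g)%g; rewrite ?groupM // !permM sa; split=> //.
    have [gA gl gh] := inD _ gD; have [_ c2] := dia _ _ lx xy yh.
    apply: (pair_other (a := y) c2).
    + by rewrite !inE xy yh.
    + rewrite inE; apply/andP; split; first by rewrite -gx aut_lt // -sa aut_lt.
      by rewrite -gh aut_lt // -sh aut_lt.
    + by rewrite !inE xy' yh'.
    + by rewrite -gy (inj_eq perm_inj); apply/eqP.
    + by rewrite eq_sym.
rewrite card_in_imset // => g h gD hD [ga gb].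
have [gA gl gh] := inD _ gD; have [hA hl hh] := inD _ hD.
apply/eqP; rewrite eq_mulgV1; apply/eqP; apply: free; rewrite ?groupM ?groupV //.
- by rewrite permM gl -{1}hl permK.
- by rewrite permM gh -{1}hh permK.
- by rewrite permM ga permK.
- by rewrite permM gb permK.
Qed.

(** * The reflections of a base flag and the orders of the rotations *)

Section BaseFlag.
Variables (v e F : P) (r0 r1 r2 : {perm P}).
Hypothesis flagA : is_flag v e F.

Lemma reflection0P : is_reflection rk (mkflag v e F) 0 r0 <->
  [/\ r0 \in automorphisms P, r0 v <> v, r0 e = e & r0 F = F].
Proof.
split=> [/andP[sA]|[sA h1 h2 h3]].
  by rewrite aut_mkflag // => /adjacent0[] //; rewrite ?aut_flag.
by rewrite /is_reflection sA aut_mkflag //; apply/adjacent0; rewrite ?aut_flag.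
Qed.

Lemma reflection1P : is_reflection rk (mkflag v e F) 1 r1 <->
  [/\ r1 \in automorphisms P, r1 v = v, r1 e <> e & r1 F = F].
Proof.
split=> [/andP[sA]|[sA h1 h2 h3]].
  by rewrite aut_mkflag // => /adjacent1[] //; rewrite ?aut_flag.
by rewrite /is_reflection sA aut_mkflag //; apply/adjacent1; rewrite ?aut_flag.
Qed.

Lemma reflection2P : is_reflection rk (mkflag v e F) 2 r2 <->
  [/\ r2 \in automorphisms P, r2 v = v, r2 e = e & r2 F <> F].
Proof.
split=> [/andP[sA]|[sA h1 h2 h3]].
  by rewrite aut_mkflag // => /adjacent2[] //; rewrite ?aut_flag.
by rewrite /is_reflection sA aut_mkflag //; apply/adjacent2; rewrite ?aut_flag.
Qed.

(** Each relation holds because the element in question fixes the base flag, on which automorphisms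
    act freely. *)
Lemma base_relations : is_reflection rk (mkflag v e F) 0 r0 ->
    is_reflection rk (mkflag v e F) 1 r1 -> is_reflection rk (mkflag v e F) 2 r2 ->
  [/\ (r0 * r0 = 1)%g, (r1 * r1 = 1)%g, (r2 * r2 = 1)%g & (r0 * r2 = r2 * r0)%g].
Proof.
move=> /reflection0P[A0 a0 b0 c0] /reflection1P[A1 a1 b1 c1] /reflection2P[A2 a2 b2 c2].
have [d0 d1 d2] := flag_diamond flagA; have [m0 m1 m2] := flag_sections flagA.
have sq (s : {perm P}) x y a : s \in automorphisms P -> s x = x -> s y = y ->
    #|proper_section x y| = 2 -> a \in proper_section x y -> s a <> a -> s (s a) = a.
  move=> sA sx sy cS aS /eqP sa; apply: (pair_other cS (a := s a));
    by rewrite ?(aut_section _ sA sx sy) // ?(inj_eq perm_inj) // eq_sym.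
have q0 := sq r0 _ _ _ A0 (aut_bot A0) b0 d0 m0 a0.
have q1 := sq r1 _ _ _ A1 a1 c1 d1 m1 b1.
have q2 := sq r2 _ _ _ A2 b2 (aut_top A2) d2 m2 c2.
have r0r0 : (r0 * r0 = 1)%g by apply: (aut_free _ flagA); rewrite ?groupM ?permM ?b0 ?c0.
have r1r1 : (r1 * r1 = 1)%g by apply: (aut_free _ flagA); rewrite ?groupM ?permM ?a1 ?c1.
have r2r2 : (r2 * r2 = 1)%g by apply: (aut_free _ flagA); rewrite ?groupM ?permM ?a2 ?b2.
split=> //.
(* [r2] fixes the base edge and one of its ends, hence the other end; dually, [r0] fixes the second
   2-face on the edge. *)
have e0 : r2 (r0 v) = r0 v.
  by apply: (aut_other A2 (aut_bot A2) b2 d0 m0) => //; rewrite aut_section ?aut_bot.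
have e2 : r0 (r2 F) = r2 F.
  by apply: (aut_other A0 b0 (aut_top A0) d2 m2) => //; rewrite aut_section ?aut_top.
apply/eqP; rewrite eq_mulgV1; apply/eqP; apply: (aut_free _ flagA).
- by rewrite groupM ?groupV ?groupM.
- by rewrite invMg !permM e0 -{1}a2 -{1}q0 !permK.
- by rewrite invMg !permM b0 b2 -{1}b0 permK -{1}b2 permK.
- by rewrite invMg !permM c0 -{1}e2 permK permK.
Qed.

(** The orders come from the polygons of the base 2-face and the base vertex. A common power [g]
    fixes [v] and [F], so it sends [e] to [e] or to [r1 e]; by freeness [g] is 1 or [r1], and [r1]
    is not a power of [r0 * r1]. *)
Lemma base_orders : (1 < p)%N -> (1 < q)%N ->
    is_reflection rk (mkflag v e F) 0 r0 ->
    is_reflection rk (mkflag v e F) 1 r1 -> is_reflection rk (mkflag v e F) 2 r2 ->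
  [/\ #[r0 * r1]%g = p, #[r1 * r2]%g = q & (<[r0 * r1]> :&: <[r1 * r2]> = 1)%g].
Proof.
move=> p1 q1 R0 R1 R2; have [r0r0 r1r1 r2r2 _] := base_relations R0 R1 R2.
move: R0 R1 R2.
move=> /reflection0P[A0 a0 b0 c0] /reflection1P[A1 a1 b1 c1] /reflection2P[A2 a2 b2 c2].
case/and4P: (flagA) => f1 f2 f3 f4.
have [op r1X] : #[r0 * r1]%g = p /\ r1 \notin <[r0 * r1]>%g.
  apply: (@polygon_rotation p \bot F v e) => //; first exact: face_polygon flagA.
  - by split=> //; apply: aut_bot.
  - by split=> //; apply: aut_bot.
  - by move=> g gA _ gF gv ge; apply: aut_free gA flagA gv ge gF.
  - by move=> a b h1 h2 h3; have [d0 d1 _] := flag_diamond (is_flagI h1 h2 h3 f4).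
have [oq _] : #[r1 * r2]%g = q /\ r2 \notin <[r1 * r2]>%g.
  apply: (@polygon_rotation q v \top e F) => //; first exact: vertex_polygon flagA.
  - by split=> //; apply: aut_top.
  - by split=> //; apply: aut_top.
  - by move=> g gA gv _ ge gF; apply: aut_free gA flagA gv ge gF.
  - by move=> a b h1 h2 h3; have [_ d0 d1] := flag_diamond (is_flagI f1 h1 h2 h3).
split=> //; apply/trivgP/subsetP=> g /setIP[gX gY]; apply/set1gP.
have gA : g \in automorphisms P.
  by move: g gX {gY}; apply/subsetP; rewrite cycle_subG groupM.
have gF : g F = F.
  by apply: gen_fixed gX => h /set1P->; rewrite permM c0.
have gv : g v = v.
  by apply: gen_fixed gY => h /set1P->; rewrite permM a1.
have [ge|ge] := eqVneq (g e) e; first exact: aut_free gA flagA gv ge gF.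
have [_ d1 _] := flag_diamond flagA; have [_ m1 _] := flag_sections flagA.
have ger : g e = r1 e.
  by apply: (pair_other d1 m1); rewrite ?aut_section //; apply/eqP.
suff gr : (g * r1 = 1)%g.
  have e1 : (g^-1 = r1)%g by rewrite -[LHS]mulg1 -gr mulKg.
  by move: gX; rewrite -groupV e1 (negPf r1X).
apply: (aut_free _ flagA); rewrite ?groupM // permM ?gv ?gF //.
by rewrite ger -permM r1r1 perm1.
Qed.

End BaseFlag.
End Polyhedron.

(** An index of at least 3 would give [a] at least [3 * m], and index 0 would give [a = 0]. *)
Lemma index_two m r a i :
  r * i = a -> a <= 2 * m -> m <= r -> 0 < m -> 0 < a -> i != 1 -> i = 2.
Proof.
case: i => [|[|[|k]]] //; first by rewrite muln0 => <-.
rewrite !mulnS; move: (r * k)%N => c; lia.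
Qed.

(** * Tight polyhedra: the arithmetic conditions, and regularity by counting *)

Section TightPolyhedron.
Local Open Scope group_scope.
Variables (d : Order.disp_t) (P : finTBPOrderType d) (rk : P -> int) (p q : nat).
Hypotheses (polyP : is_polyhedron rk) (typeP : has_type rk p q).
Hypotheses (p_gt1 : 1 < p) (q_gt1 : 1 < q).

Lemma card_flag_orbit (A : {set P}) : A \in flags P ->
  #|orbit 'P^* (automorphisms P) A| = #|automorphisms P|.
Proof.
have [rk_lt rk_codom card_flag _ _] := polyP.
case/(flagsP rk_lt rk_codom card_flag) => v [e [F [f ->]]].
have stab1 : 'C_(automorphisms P)[mkflag v e F | 'P^*] = 1; last first.
  by rewrite (card_orbit _ [group of automorphisms P]) stab1 indexg1.
apply/trivgP/subsetP=> g /setIP[gA /astab1P gE].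
have : mkflag (g v) (g e) (g F) = mkflag v e F by rewrite -aut_mkflag.
have f' : is_flag (g v) (g e) (g F) by rewrite aut_flag.
case/(mkflag_inj rk_lt rk_codom f' f) => gv ge gF.
by apply/set1gP; apply: (aut_free polyP typeP) f gv ge gF.
Qed.

Lemma orbit_flags (A : {set P}) : A \in flags P ->
  orbit 'P^* (automorphisms P) A \subset flags P.
Proof.
have [rk_lt rk_codom card_flag _ _] := polyP.
case/(flagsP rk_lt rk_codom card_flag) => v [e [F [f ->]]].
apply/subsetP=> _ /orbitP[g gA <-].
change (g @: mkflag v e F \in flags P).
by rewrite aut_mkflag // (mkflag_flags rk_lt rk_codom) // aut_flag.
Qed.

Lemma tight_orientably_regular_condition : tight P p q -> orientably_regular rk ->
  [/\ ~~ odd p || ~~ odd q, odd p -> q %| 2 * p & odd q -> p %| 2 * q]%N.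
Proof.
have [rk_lt rk_codom card_flag _ _] := polyP.
move=> tightP [reg [A [r0 [r1 [r2 [fA]]]]]].
(* Transitivity and freeness make the number of automorphisms equal to the number of flags. *)
have cAut : #|automorphisms P| = (2 * p * q)%N.
  by rewrite -(card_flag_orbit fA) (atransP reg _ fA).
have [v [e [F [f ->]]]] := flagsP rk_lt rk_codom card_flag fA.
move=> R0 R1 R2 idx.
have [r00 r11 r22 r02] := base_relations polyP typeP f R0 R1 R2.
have [ox oy tiXY] := base_orders polyP typeP f p_gt1 q_gt1 R0 R1 R2.
have rV (r : {perm P}) : r * r = 1 -> r^-1 = r.
  by move=> rr; apply/eqP; rewrite eq_invg_mul rr.
have A0 : r0 \in automorphisms P by case/andP: R0.
have A1 : r1 \in automorphisms P by case/andP: R1.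
have A2 : r2 \in automorphisms P by case/andP: R2.
set x := r0 * r1 in ox tiXY idx; set y := r1 * r2 in oy tiXY idx.
set R := <<[set x; y]>> in idx.
have cR : #|R| = (p * q)%N.
  have RA : R \subset automorphisms P by rewrite gen_subG subUset !sub1set !groupM.
  have := Lagrange RA; rewrite idx cAut -mulnA mulnC => /eqP.
  by rewrite eqn_pmul2l // => /eqP.
have xR : x \in R by rewrite mem_gen // !inE eqxx.
have yR : y \in R by rewrite mem_gen // !inE eqxx orbT.
(* Both products of the cyclic groups have [p * q] elements, the order of the rotation group, so
   both equal it and the factors permute. *)
have XY : <[x]> * <[y]> = R.
  apply/eqP; rewrite eqEcard mul_subG ?cycle_subG //= (TI_cardMg tiXY) cR.
  by rewrite -!orderE ox oy.
have YX : <[y]> * <[x]> = R.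
  apply/eqP; rewrite eqEcard mul_subG ?cycle_subG //= TI_cardMg ?cR 1?setIC //.
  by rewrite -!orderE ox oy mulnC.
have txy : tight_rotations x y r1.
  split=> //; last by rewrite /commute XY YX.
  - by rewrite conjgE invMg !rV // -mulgA r11 mulg1.
  - by rewrite conjgE invMg !rV // !mulgA r11 mul1g.
  - have -> : x * y = r0 * r2 by rewrite /x /y mulgA -(mulgA r0) r11 mulg1.
    by rewrite expg2 {1}r02 mulgA -(mulgA r2) r00 mulg1.
split.
(* If [p] and [q] were odd, [x * y] would be trivial, having square 1 in a group of odd order. Then
   [x] would lie in [<[y]>], hence be 1. *)
- rewrite -negb_and -oddM -cR; apply/negP=> oR.
  have xy1 : x * y = 1.
    have /eqP cop : coprime 2 #|R| by rewrite coprime2n.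
    have [_ _ xy2 _ _] := txy.
    have oxy : #[x * y] %| #|R| by apply: (@order_dvdG _ [group of R]); rewrite groupM.
    by apply/eqP; rewrite -[x * y]expg1 -order_dvdn -cop dvdn_gcd oxy order_dvdn xy2 eqxx.
  have : x \in <[x]> :&: <[y]>.
    by rewrite inE cycle_id -(mulgK y x) xy1 mul1g groupV cycle_id.
  by rewrite tiXY => /set1gP x1; move: p_gt1; rewrite -ox x1 order1.
- move=> oddp; rewrite -oy order_dvdn -ox; apply/eqP.
  by apply: (tight_rotations_order_dvd txy); apply: (tight_rotations_commute txy); rewrite ox.
- move=> oddq; rewrite -ox -orderV order_dvdn -oy -(orderV y); apply/eqP.
  have txy' := tight_rotationsC txy.
  apply: (tight_rotations_order_dvd txy'); apply: (tight_rotations_commute txy').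
  by rewrite orderV oy.
Qed.

(* Conversely, regularity follows by counting: the rotations already account
   for half of the flags and no automorphism but 1 fixes a flag. *)
Lemma orientably_regular_count (v e F : P) (r0 r1 r2 : {perm P}) :
    tight P p q -> is_flag v e F ->
    is_reflection rk (mkflag v e F) 0 r0 -> is_reflection rk (mkflag v e F) 1 r1 ->
    is_reflection rk (mkflag v e F) 2 r2 ->
    r0 \notin <<[set r0 * r1; r1 * r2]>> ->
  orientably_regular rk.
Proof.
have [rk_lt rk_codom card_flag _ _] := polyP.
move=> tightP f R0 R1 R2 r0R.
have fA := mkflag_flags rk_lt rk_codom f.
have [ox oy tiXY] := base_orders polyP typeP f p_gt1 q_gt1 R0 R1 R2.
have A0 : r0 \in automorphisms P by case/andP: R0.
have A1 : r1 \in automorphisms P by case/andP: R1.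
have A2 : r2 \in automorphisms P by case/andP: R2.
set R := <<_>> in r0R.
have RA : R \subset automorphisms P by rewrite gen_subG subUset !sub1set !groupM.
have leR : (p * q <= #|R|)%N.
  rewrite -ox -oy !orderE -(TI_cardMg tiXY) subset_leq_card //.
  by rewrite mul_subG ?cycle_subG // mem_gen // !inE eqxx ?orbT.
have leA : (#|automorphisms P| <= 2 * p * q)%N.
  by rewrite -tightP -(card_flag_orbit fA) subset_leq_card ?orbit_flags.
have idx1 : #|automorphisms P : R| != 1%N.
  by apply: contra r0R => /eqP/(index1g RA) /= eR; rewrite /R eR.
have pq0 : (0 < p * q)%N by rewrite muln_gt0 (ltnW p_gt1) (ltnW q_gt1).
have A_gt0 : (0 < #|automorphisms P|)%N by apply: (cardG_gt0 [group of automorphisms P]).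
have idx : #|automorphisms P : R| = 2.
  by rewrite -mulnA in leA; exact: (index_two (Lagrange RA) leA leR pq0 A_gt0 idx1).
split.
  apply/imsetP; exists (mkflag v e F) => //; apply/eqP; rewrite eq_sym eqEcard orbit_flags //.
  by rewrite (card_flag_orbit fA) tightP -(Lagrange RA) idx -mulnA mulnC leq_mul2r leR orbT.
by exists (mkflag v e F), r0, r1, r2.
Qed.

End TightPolyhedron.

(** * Flat posets *)

Section Graded.
Local Open Scope order_scope.
Variables (d : Order.disp_t) (P : finTBPOrderType d) (rk : P -> int).
Hypothesis rk_lt : {homo rk : x y / x < y}.
Hypothesis rk_codom : forall i : int, (i \in codom rk) = (- 1 <= i <= 3)%R.
Hypothesis dense : forall x y : P, x < y -> (rk x + Posz 1 < rk y)%R ->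
  exists z, x < z < y.

Lemma le_rank x y : x >=< y -> (rk x <= rk y)%R -> x <= y.
Proof. by case: comparableP => // /rk_lt; rewrite leNgt => ->. Qed.

(** If a maximal chain missed a rank, take its nearest members [x] below and [y] above the gap. A
    face strictly between them is comparable with the whole chain, so it belongs to it, against the
    choice of [x] or [y]. *)
Lemma graded_card_flag A : A \in flags P -> #|A| = 5%N.
Proof.
rewrite inE => /maxsetP[/forall_inP cA maxA].
have cmp x y : x \in A -> y \in A -> x >=< y.
  by move=> xA; apply: (forall_inP (cA x xA)).
have add z : (forall x, x \in A -> x >=< z) -> z \in A.
  move=> zA; suff <- : z |: A = A by rewrite setU11.
  apply: maxA (subsetUr _ _); apply/forall_inP=> x; rewrite !inE => /orP[/eqP->|xA];
  apply/forall_inP=> y; rewrite !inE => /orP[/eqP->|yA]; rewrite ?comparablexx //.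
  - by rewrite comparable_sym zA.
  - exact: zA.
  - exact: cmp.
have botA : \bot \in A by apply: add => x _; rewrite comparable_sym /Order.comparable le0x.
have topA : \top \in A by apply: add => x _; rewrite /Order.comparable lex1.
have rb := rank_bot rk_lt rk_codom; have rt := rank_top rk_lt rk_codom.
pose r x : 'I_5 := inord `|(rk x + Posz 1)%R|.
have rE x : nat_of_ord (r x) = `|(rk x + Posz 1)%R|%N.
  by rewrite inordK //; have := rank_bounds rk_codom x; lia.
have inj : {in A &, injective r}.
  move=> x y xA yA /(congr1 val) /=; rewrite !rE => rxy.
  have := cmp x y xA yA; have := rank_bounds rk_codom x; have := rank_bounds rk_codom y.
  by case: comparableP => // /rk_lt; lia.
rewrite -(card_in_imset inj); suff -> : r @: A = setT by rewrite cardsT card_ord.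
apply/setP=> j; rewrite inE; apply/idP; apply: contraT => jA.
(* The level [j] stands for the missing rank [j - 1]. *)
have rj x : x \in A -> (rk x + Posz 1 != Posz j)%R.
  move=> xA; apply: contra jA => /eqP e; apply/imsetP; exists x => //.
  by apply: val_inj; rewrite /= rE e.
have j0 : (Posz 0 < Posz j)%R by have := rj _ botA; rewrite rb; lia.
have j5 : (Posz j < Posz 4)%R by have := rj _ topA; rewrite rt; have := ltn_ord j; lia.
pose below x := (x \in A) && (rk x + Posz 1 < Posz j)%R.
pose above x := (x \in A) && (Posz j < rk x + Posz 1)%R.
have below0 : below \bot by rewrite /below botA rb; lia.
have above1 : above \top by rewrite /above topA rt; lia.
case: (Order.TotalTheory.arg_maxP rk below0) => x /andP[xA rx] maxx.
case: (Order.TotalTheory.arg_minP rk above1) => y /andP[yA ry] miny.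
have xy : x < y by apply: (lt_rank rk_lt) (cmp _ _ xA yA) _; lia.
have [|z /andP[xz zy]] := dense xy; first lia.
have := rk_lt xz; have := rk_lt zy => rzy rxz.
have zA : z \in A.
  apply: add => w wA; have nj := rj _ wA.
  have [lw|] := boolP (below w).
    have wx := le_rank (cmp _ _ wA xA) (maxx _ lw).
    by rewrite /Order.comparable (ltW (le_lt_trans wx xz)).
  rewrite /below wA /= => nb.
  have aw : above w by rewrite /above wA lt_neqAle eq_sym nj leNgt nb.
  have yw := le_rank (cmp _ _ yA wA) (miny _ aw).
  by rewrite /Order.comparable (ltW (lt_le_trans zy yw)) orbT.
have nj := rj _ zA; have [lz|] := boolP (below z).
  by have /= := maxx _ lz; rewrite leNgt rxz.
rewrite /below zA /= => nb.
have az : above z by rewrite /above zA lt_neqAle eq_sym nj leNgt nb.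
by have /= := miny _ az; rewrite leNgt rzy.
Qed.

Lemma polygon_connected n (lo hi : P) : 0 < n -> is_polygon n lo hi -> section_connected lo hi.
Proof.
case: n => // n _ [f [injf monof codf]] z w zS wS.
set r := fun _ _ => _.
have inS u : f u \in proper_section lo hi by rewrite -codf codom_f.
have symr : symmetric r.
  by move=> x y; rewrite /r comparable_sym andbCA.
have step (i j : 'I_n.+1) : (i == j) || (i == ordS j) -> r (f (inl i)) (f (inr j)).
  by move=> ij; rewrite /r !inS /Order.comparable monof /= ij.
have conn u : connect r (f (inl ord0)) (f u).
  have base i : connect r (f (inl ord0)) (f (inl i)).
    apply: (@ordS_ind _ (fun i => connect r (f (inl ord0)) (f (inl i))) _ ord0) => // k.
    move/connect_trans; apply; apply: (@connect_trans _ _ (f (inr k))).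
      by apply: connect1; apply: step; rewrite eqxx.
    by apply: connect1; rewrite symr; apply: step; rewrite eqxx orbT.
  case: u => [i|i]; first exact: base.
  by apply: connect_trans (base i) _; apply: connect1; apply: step; rewrite eqxx.
move: zS wS; rewrite -!codf => /codomP[u ->] /codomP[u' ->].
by apply: connect_trans (conn u'); rewrite (sym_connect_sym symr).
Qed.

End Graded.

(** Products of two reflections preserve a sign that each reflection reverses, and the automorphisms
    preserving it form a group [H]. This group contains all rotations but not [r0]. *)
Lemma sign_not_rotation (d : Order.disp_t) (P : finTBPOrderType d)
    (sgn : P -> P -> P -> bool) (v e F : P) (r0 r1 r2 : {perm P}) :
    is_flag v e F ->
    (forall r, r \in [set r0; r1; r2] -> r \in automorphisms P /\
       forall x y z, is_flag x y z -> sgn (r x) (r y) (r z) = ~~ sgn x y z) ->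
  r0 \notin <<[set r0 * r1; r1 * r2]>>%g.
Proof.
move=> f flip; pose H := [set s in automorphisms P | [forall x, forall y, forall z,
  is_flag x y z ==> (sgn (s x) (s y) (s z) == sgn x y z)]].
have HP s : reflect (s \in automorphisms P /\
    forall x y z, is_flag x y z -> sgn (s x) (s y) (s z) = sgn x y z) (s \in H).
  rewrite [X in reflect _ X]in_set; apply: (iffP idP) => [/andP[sA h]|[sA h]].
    split=> // x y z fl; apply/eqP.
    by move/forallP/(_ x)/forallP/(_ y)/forallP/(_ z)/implyP: h; apply.
  rewrite sA; apply/forallP=> x; apply/forallP=> y; apply/forallP=> z.
  by apply/implyP=> fl; apply/eqP/h.
have Hgroup : group_set H.
  apply/group_setP; split.
    by apply/HP; split=> [|x y z _]; rewrite ?group1 ?perm1.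
  move=> s t /HP[sA hs] /HP[tA ht]; apply/HP; split=> [|x y z fl]; first by rewrite groupM.
  by rewrite !permM ht ?aut_flag // hs.
have pair r s : r \in [set r0; r1; r2] -> s \in [set r0; r1; r2] -> (r * s)%g \in H.
  case/flip=> rA hr /flip[sA hs]; apply/HP; split=> [|x y z fl]; first by rewrite groupM.
  by rewrite !permM hs ?aut_flag // hr // negbK.
apply/negP=> r0R; have : r0 \in H.
  move: r0R; apply/subsetP; rewrite -[H]/(gval (Group Hgroup)) gen_subG subUset !sub1set.
  by rewrite /= !pair // !inE eqxx ?orbT.
have [_ h0] : r0 \in automorphisms P /\
    forall x y z, is_flag x y z -> sgn (r0 x) (r0 y) (r0 z) = ~~ sgn x y z.
  by apply: flip; rewrite !inE eqxx.
by case/HP=> _ /(_ _ _ _ f); rewrite h0 //; case: (sgn v e F).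
Qed.

Section FlatPoset.
Variables (V E F : finType) (e0 e1 : E -> V) (f0 f1 : E -> F).

Definition incident (X : eqType) (g0 g1 : E -> X) (x : X) (e : E) : bool :=
  (x == g0 e) || (x == g1 e).

(** The incidence maps are phantom arguments: the carrier ignores them, but the order attached to
    the type depends on them. *)
Definition flat_face (_ _ : E -> V) (_ _ : E -> F) : Type := (bool + (V + E + F))%type.
Local Notation face := (flat_face e0 e1 f0 f1).

HB.instance Definition _ := Finite.on face.

(* [inl false] and [inl true] are the least and the greatest face; every vertex
   lies on every 2-face. *)
Definition flat_le (x y : face) : bool :=
  match x, y with
  | inl false, _ => true
  | _, inl true => true
  | inr (inl (inl v)), inr (inl (inl w)) => v == w
  | inr (inl (inl v)), inr (inl (inr e)) => incident e0 e1 v e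
  | inr (inl (inl _)), inr (inr _) => true
  | inr (inl (inr e)), inr (inl (inr e')) => e == e'
  | inr (inl (inr e)), inr (inr c) => incident f0 f1 c e
  | inr (inr c), inr (inr c') => c == c'
  | _, _ => false
  end.

Lemma flat_le_refl : reflexive flat_le.
Proof. by move=> [[]|[[v|e]|c]] /=. Qed.

Lemma flat_le_anti : antisymmetric flat_le.
Proof.
by move=> [[]|[[v|e]|c]] [[]|[[v'|e']|c']] //=; rewrite ?andbF // => /andP[/eqP->].
Qed.

Lemma flat_le_trans : transitive flat_le.
Proof.
by move=> [[]|[[v|e]|c]] [[]|[[v'|e']|c']] [[]|[[v''|e'']|c'']] //=; 
  try (by move/eqP->); try (by move=> + /eqP<-).
Qed.

HB.instance Definition _ := Order.Le_isPOrder.Build (Order.Disp tt tt) face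
  flat_le_refl flat_le_anti flat_le_trans.

Lemma flat_bot (x : face) : (inl false <= x :> face)%O.
Proof. by []. Qed.

Lemma flat_top (x : face) : (x <= inl true :> face)%O.
Proof. by case: x => [[]|[[v|e]|c]]. Qed.

HB.instance Definition _ := Order.hasBottom.Build _ face flat_bot.
HB.instance Definition _ := Order.hasTop.Build _ face flat_top.

Definition flat_height (x : face) : nat :=
  match x with
  | inl false => 0
  | inr (inl (inl _)) => 1
  | inr (inl (inr _)) => 2
  | inr (inr _) => 3
  | inl true => 4
  end.

Definition flat_rank (x : face) : int := (Posz (flat_height x) - 1)%R.

Lemma flat_ltE (x y : face) : (x < y)%O = (flat_height x < flat_height y) && flat_le x y.
Proof.
rewrite lt_neqAle -[(x <= y)%O]/(flat_le x y).
case: x => [[]|[[v|e]|c]]; case: y => [[]|[[v'|e']|c']] //=; rewrite ?andbT ?andbF //.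
- by rewrite eqE /= eqE /= eqE /= andNb.
- by rewrite eqE /= eqE /= eqE /= andNb.
- by rewrite eqE /= eqE /= andNb.
Qed.

Lemma flat_rank_lt : {homo flat_rank : x y / (x < y)%O >-> (x < y)%R}.
Proof. by move=> x y; rewrite flat_ltE /flat_rank ltrD2r ltz_nat => /andP[]. Qed.

End FlatPoset.

(** [b] lists the edges on [c] in cyclic order and [a] the vertices between them. Bijectivity of [a]
    is flatness: the cycle meets every vertex exactly once. Exchanging the two kinds of maps gives
    the condition around a vertex. *)
Definition cycles_around (V E F : finType) (e0 e1 : E -> V) (f0 f1 : E -> F) n :=
  forall c : F, exists (a : 'I_n -> V) (b : 'I_n -> E),
    [/\ bijective a, injective b, forall e, incident f0 f1 c e = (e \in codom b)
      & forall j, incident e0 e1 (a j) (b j) && incident e0 e1 (a (ordS j)) (b j)].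

(** The distinct vertices [a j] and [a (ordS j)] exhaust the two ends of [b j]. *)
Lemma cycle_incident (V E : finType) (e0 e1 : E -> V) n (a : 'I_n -> V) (b : 'I_n -> E) :
    1 < n -> injective a -> (forall e, e0 e != e1 e) ->
    (forall j, incident e0 e1 (a j) (b j) && incident e0 e1 (a (ordS j)) (b j)) ->
  forall i j, incident e0 e1 (a i) (b j) = (i == j) || (i == ordS j).
Proof.
move=> n1 inja ne inc i j; rewrite -(inj_eq inja) -(inj_eq inja i (ordS j)).
have := neq_ordS j n1; rewrite -(inj_eq inja) => /negPf njS.
have := inc j; rewrite /incident.
case/andP=> /orP[]/eqP h0 /orP[]/eqP h1; move: njS; rewrite h0 h1 ?eqxx // orbC //.
Qed.

(** * Polyhedra built from edges arranged in cycles *)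

Section FlatPolyhedron.
Variables (V E F : finType) (e0 e1 : E -> V) (f0 f1 : E -> F) (p q : nat).
Local Notation face := (flat_face e0 e1 f0 f1).
Local Notation fV v := (inr (inl (inl v)) : face).
Local Notation fE e := (inr (inl (inr e)) : face).
Local Notation fF c := (inr (inr c) : face).
Local Notation rank := (@flat_rank V E F e0 e1 f0 f1).
Let rk_lt : {homo rank : x y / (x < y)%O >-> (x < y)%R} := @flat_rank_lt _ _ _ e0 e1 f0 f1.

Hypotheses (neq_e : forall e, e0 e != e1 e) (neq_f : forall e, f0 e != f1 e).
Hypotheses (p_gt1 : 1 < p) (q_gt1 : 1 < q).
Hypothesis cycF : cycles_around e0 e1 f0 f1 p.
Hypothesis cycV : cycles_around f0 f1 e0 e1 q.
Variable edge : E.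

(** The diamond condition between a vertex and a 2-face: the vertex occurs once on the cycle, at
    position [i], between the edges [b (ord_pred i)] and [b i]. *)
Lemma card_edges v c : #|[set e | incident e0 e1 v e && incident f0 f1 c e]| = 2.
Proof.
have [a [b [bija injb bP inc]]] := cycF c; have [a' aK a'K] := bija.
have incE := cycle_incident p_gt1 (bij_inj bija) neq_e inc.
set i := a' v; have -> : v = a i by rewrite a'K.
have -> : [set e | incident e0 e1 (a i) e && incident f0 f1 c e] = [set b i; b (ord_pred i)].
  apply/setP=> e; rewrite !inE bP; apply/andP/orP.
    case=> + /codomP[j ej]; rewrite ej incE => /orP[]/eqP->; [by left|right].
    by rewrite ordSK.
  by case=> /eqP->; rewrite incE codom_f ?ord_predK !eqxx ?orbT.
rewrite cards2 (inj_eq injb) -{1}(ord_predK i) eq_sym.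
by rewrite neq_ordS.
Qed.

Lemma flat_codom (i : int) : (i \in codom rank) = (- 1 <= i <= 3)%R.
Proof.
apply/codomP/idP=> [[x ->]|]; first by case: x => [[]|[[v|e]|c]].
case: i => [[|[|[|[|n]]]]|[|n]] // _.
- by exists (fV (e0 edge)).
- by exists (fE edge).
- by exists (fF (f0 edge)).
- by exists (inl true : face).
- by exists (inl false : face).
Qed.

Lemma flat_dense (x y : face) : (x < y)%O -> (rank x + Posz 1 < rank y)%R ->
  exists z, (x < z < y)%O.
Proof.
rewrite /flat_rank addrAC ltrD2r -PoszD ltz_nat addn1 => xy.
case: x xy => [[]|[[v|e]|c]]; case: y => [[]|[[v'|e']|c']] //= xy _.
- by exists (fE edge).
- by exists (fV (e0 e')); rewrite !flat_ltE /= /incident eqxx.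
- by exists (fV (e0 edge)).
- by exists (fF (f0 edge)).
- have : 0 < #|[set e | incident e0 e1 v e && incident f0 f1 c' e]| by rewrite card_edges.
  case/card_gt0P=> e; rewrite inE => /andP[ve ce].
  by exists (fE e); rewrite !flat_ltE /= ve ce.
- by exists (fF (f0 e)); rewrite !flat_ltE /= /incident eqxx.
Qed.

Lemma flat_face_polygon c : is_polygon p (\bot%O : face) (fF c).
Proof.
have [a [b [bija injb bP inc]]] := cycF c; have [a' aK a'K] := bija.
have incE := cycle_incident p_gt1 (bij_inj bija) neq_e inc.
exists (fun u => match u with inl i => fV (a i) | inr j => fE (b j) end); split.
- by move=> [i|i] [j|j] // []; [move/(bij_inj bija)-> | move/injb->].
- move=> [i|i] [j|j] //=; rewrite -[(_ <= _)%O]/(flat_le _ _) /= ?incE //.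
    by rewrite (inj_eq (bij_inj bija)).
  by rewrite (inj_eq injb).
move=> z; rewrite inE !flat_ltE /=; apply/codomP/idP=> [[[i|j] ->] //=|].
  by rewrite bP codom_f.
case: z => [[]|[[v|e]|c']] //=; first by exists (inl (a' v)); rewrite a'K.
by rewrite bP => /codomP[j ->]; exists (inr j).
Qed.

Lemma flat_vertex_polygon v : is_polygon q (fV v) (\top%O : face).
Proof.
have [a [b [bija injb bP inc]]] := cycV v; have [a' aK a'K] := bija.
have incE := cycle_incident q_gt1 (bij_inj bija) neq_f inc.
have injS : injective (@ordS q) := can_inj (@ordSK q).
(* Edges now act as vertices of the polygon. The 2-face shared by [b j] and [b (ordS j)] is
   [a (ordS j)], whence the shift. *)
exists (fun u => match u with inl i => fE (b i) | inr j => fF (a (ordS j)) end); split.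
- by move=> [i|i] [j|j] // []; [move/injb-> | move/(bij_inj bija)/injS->].
- move=> [i|i] [j|j] //=; rewrite -[(_ <= _)%O]/(flat_le _ _) /= ?incE //.
  + by rewrite (inj_eq injb).
  + by rewrite (inj_eq injS) orbC eq_sym [ordS j == i]eq_sym.
  + by rewrite (inj_eq (bij_inj bija)) (inj_eq injS).
move=> z; rewrite inE !flat_ltE /=; apply/codomP/idP=> [[[i|j] ->] //=|].
  by rewrite bP codom_f.
case: z => [[]|[[v'|e]|c]] //=; first by rewrite bP => /andP[/codomP[j ->] _]; exists (inl j).
by move=> _; exists (inr (ord_pred (a' c))); rewrite ord_predK a'K.
Qed.

Lemma flat_type : has_type rank p q.
Proof.
split=> [[[]|[[v|e]|c]]|[[]|[[v|e]|c]]] // _; first exact: flat_face_polygon.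
exact: flat_vertex_polygon.
Qed.

(** Every vertex lies on every 2-face, so each proper face is linked to one fixed 2-face, through a
    vertex if necessary. *)
Lemma flat_connected : section_connected (\bot%O : face) \top%O.
Proof.
move=> z w zS wS; set r := fun _ _ => _.
have symr : symmetric r by move=> x y; rewrite /r comparable_sym andbCA.
have inS (x : face) : (x \in proper_section (\bot%O : face) \top%O) =
    (0 < flat_height x < 4) by rewrite inE !flat_ltE; case: x => [[]|[[v|e]|c]].
have base x : x \in proper_section (\bot%O : face) \top%O -> connect r x (fF (f0 edge)).
  have vert v : connect r (fV v) (fF (f0 edge)).
    by apply: connect1; rewrite /r !inS /=.
  rewrite inS; case: x => [[]|[[v|e]|c]] //= _.
    apply: connect_trans (vert (e0 e)); apply: connect1; rewrite symr /r !inS /=.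
    by rewrite /Order.comparable -[(_ <= _)%O]/(flat_le _ _) /= /incident eqxx.
  apply: connect_trans (vert (e0 edge)); apply: connect1; rewrite symr /r !inS /=.
  by [].
apply: connect_trans (base z zS) _.
by rewrite (sym_connect_sym symr) base.
Qed.

Lemma flat_diamond (x y : face) : (x <= y)%O -> rank y = (rank x + Posz 2)%R ->
  #|proper_section x y| = 2.
Proof.
move=> + r; have {r} : flat_height y = (flat_height x + 2)%N.
  by move: r; rewrite /flat_rank addrAC => /addIr; rewrite -PoszD => -[].
case: x => [[]|[[v|e]|c]]; case: y => [[]|[[v'|e']|c']] //= _ xy.
- have -> : proper_section (inl false : face) (fE e') = (fun v => fV v) @: [set e0 e'; e1 e'].
    apply/setP=> z; rewrite inE !flat_ltE /=; apply/idP/imsetP.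
      by case: z => [[]|[[v|e]|c]] //= h; exists v; rewrite // !inE.
    by case=> v; rewrite !inE => h ->.
  by rewrite card_imset ?cards2 ?neq_e // => u w [].
- have -> : proper_section (fV v) (fF c') =
      (fun e => fE e) @: [set e | incident e0 e1 v e && incident f0 f1 c' e].
    apply/setP=> z; rewrite inE !flat_ltE /=; apply/idP/imsetP.
      by case: z => [[]|[[u|e]|c]] //= h; exists e; rewrite // !inE.
    by case=> e; rewrite !inE => h ->.
  by rewrite card_imset ?card_edges // => u w [].
- have -> : proper_section (fE e) (inl true : face) = (fun c => fF c) @: [set f0 e; f1 e].
    apply/setP=> z; rewrite inE !flat_ltE /=; apply/idP/imsetP.
      by case: z => [[]|[[u|e'']|c]] //= /andP[h _]; exists c; rewrite // !inE.
    by case=> c; rewrite !inE => h -> /=; rewrite andbT.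
  by rewrite card_imset ?cards2 ?neq_f // => u w [].
Qed.

Lemma flat_polyhedron : is_polyhedron rank.
Proof.
split.
- exact: rk_lt.
- exact: flat_codom.
- move=> A; exact: (graded_card_flag rk_lt flat_codom flat_dense).
- move=> x y _; have -> : ((2 <= rank y - rank x - 1) = (flat_height x + 3 <= flat_height y)%N)%R.
    by rewrite /flat_rank; lia.
  case: x => [[]|[[v|e]|c]]; case: y => [[]|[[v'|e']|c']] //= _.
  + exact: flat_connected.
  + exact: polygon_connected (ltnW p_gt1) (flat_face_polygon c').
  + exact: polygon_connected (ltnW q_gt1) (flat_vertex_polygon v).
- exact: flat_diamond.
Qed.

Lemma flat_is_flag (x y z : face) : is_flag x y z ->
  exists v e c, [/\ x = fV v, y = fE e, z = fF c & incident e0 e1 v e && incident f0 f1 c e].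
Proof.
move=> f; case/and4P: f; rewrite !flat_ltE /=.
case: x => [[]|[[v|e]|c]] //=; case: y => [[]|[[v'|e']|c']] //=;
case: z => [[]|[[v''|e'']|c'']] //= _ h1 h2 _.
by exists v, e', c''; rewrite h1 h2.
Qed.

Lemma flat_flagE v e c :
  is_flag (fV v) (fE e) (fF c) = incident e0 e1 v e && incident f0 f1 c e.
Proof. by rewrite /is_flag !flat_ltE /= andbT. Qed.

(** A flag is an edge with a choice of one of its two ends and one of its two sides. *)
Lemma card_flat_flags : #|flags face| = (4 * #|E|)%N.
Proof.
pose g (u : E * bool * bool) := mkflag (fV (if u.1.2 then e0 u.1.1 else e1 u.1.1)) (fE u.1.1)
  (fF (if u.2 then f0 u.1.1 else f1 u.1.1)).
have gf u : is_flag (fV (if u.1.2 then e0 u.1.1 else e1 u.1.1)) (fE u.1.1)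
  (fF (if u.2 then f0 u.1.1 else f1 u.1.1)).
  by rewrite flat_flagE /incident; case: u => [[e []] []]; rewrite /= !eqxx ?orbT.
have injg : injective g.
  move=> u w /(mkflag_inj rk_lt flat_codom (gf u) (gf w)) [].
  case: u w => [[e s] t] [[e' s'] t'] /= [] + [] ee; rewrite ee => + [] {ee}.
  by case: s; case: s'; case: t; case: t' => // /eqP + /eqP;
    rewrite ?(negPf (neq_e _)) ?(negPf (neq_f _)) ?[_ == e0 _]eq_sym ?[_ == f0 _]eq_sym
      ?(negPf (neq_e _)) ?(negPf (neq_f _)).
have -> : flags face = g @: setT.
  apply/setP=> A; apply/idP/imsetP=> [|[u _ ->]]; last first.
    exact: (mkflag_flags rk_lt flat_codom (gf u)).
  have [_ _ cf _ _] := flat_polyhedron.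
  case/(flagsP rk_lt flat_codom cf) => x [y [z [f ->]]].
  have [v [e [c [-> -> -> /andP[ve ce]]]]] := flat_is_flag f.
  exists (e, v == e0 e, c == f0 e); rewrite ?inE // /g /=.
  move: ve ce; rewrite /incident.
  by case: (eqVneq v (e0 e)) => [-> _|_ /= /eqP->];
    case: (eqVneq c (f0 e)) => [-> _|_ /= /eqP->].
by rewrite card_imset // cardsT !card_prod card_bool; lia.
Qed.

End FlatPolyhedron.

(** * Symmetries of the incidence data, duality, and the resulting polyhedra *)

Record map_symmetry (V E F : finType) (e0 e1 : E -> V) (f0 f1 : E -> F)
    (sgn : V -> E -> F -> bool) (a : V -> V) (b : E -> E) (g : F -> F) : Prop := {
  sym_vertex : involutive a;
  sym_edge : involutive b;
  sym_face : involutive g;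
  sym_vertex_edge : forall v e, incident e0 e1 (a v) (b e) = incident e0 e1 v e;
  sym_face_edge : forall c e, incident f0 f1 (g c) (b e) = incident f0 f1 c e;
  sym_sign : forall v e c, incident e0 e1 v e -> incident f0 f1 c e ->
    sgn (a v) (b e) (g c) = ~~ sgn v e c
}.

(* [sgn] is an orientation of the flags, which all three reflections reverse. *)
Record reflexible_map (V E F : finType) (e0 e1 : E -> V) (f0 f1 : E -> F)
    (p q : nat) : Prop := {
  map_ends : forall e, e0 e != e1 e;
  map_sides : forall e, f0 e != f1 e;
  map_faces : cycles_around e0 e1 f0 f1 p;
  map_vertices : cycles_around f0 f1 e0 e1 q;
  map_edges : (4 * #|E| = 2 * p * q)%N;
  map_reflections : exists sgn v e c,
    [/\ incident e0 e1 v e, incident f0 f1 c e,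
        exists a b g, map_symmetry e0 e1 f0 f1 sgn a b g /\
          [/\ a v <> v, b e = e & g c = c],
        exists a b g, map_symmetry e0 e1 f0 f1 sgn a b g /\
          [/\ a v = v, b e <> e & g c = c]
      & exists a b g, map_symmetry e0 e1 f0 f1 sgn a b g /\
          [/\ a v = v, b e = e & g c <> c]]
}.

Lemma map_symmetry_dual (V E F : finType) (e0 e1 : E -> V) (f0 f1 : E -> F) sgn a b g :
  map_symmetry e0 e1 f0 f1 sgn a b g ->
  map_symmetry f0 f1 e0 e1 (fun c e v => sgn v e c) g b a.
Proof. by case=> aK bK gK ve ce s; split=> // c e v ce' ve'; apply: s. Qed.

(** Reversing the order exchanges the reflections moving the vertex and the 2-face and keeps the one
    moving the edge. *)
Lemma reflexible_map_dual (V E F : finType) (e0 e1 : E -> V) (f0 f1 : E -> F) p q :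
  reflexible_map e0 e1 f0 f1 p q -> reflexible_map f0 f1 e0 e1 q p.
Proof.
case=> ne nf cF cV cE [sgn [v [e [c [ve ce]]]]].
case=> a0 [b0 [g0 [/map_symmetry_dual S0 [x0 y0 z0]]]].
case=> a1 [b1 [g1 [/map_symmetry_dual S1 [x1 y1 z1]]]].
case=> a2 [b2 [g2 [/map_symmetry_dual S2 [x2 y2 z2]]]].
split=> //; first by rewrite cE -!mulnA (mulnC p).
exists (fun c e v => sgn v e c), c, e, v; split=> //.
- by exists g2, b2, a2.
- by exists g1, b1, a1.
- by exists g0, b0, a0.
Qed.

Section Realization.
Variables (V E F : finType) (e0 e1 : E -> V) (f0 f1 : E -> F) (p q : nat).
Local Notation face := (flat_face e0 e1 f0 f1).
Local Notation fV v := (inr (inl (inl v)) : face).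
Local Notation fE e := (inr (inl (inr e)) : face).
Local Notation fF c := (inr (inr c) : face).

Definition flat_action (a : V -> V) (b : E -> E) (g : F -> F) (x : face) : face :=
  match x with
  | inl t => inl t
  | inr (inl (inl v)) => fV (a v)
  | inr (inl (inr e)) => fE (b e)
  | inr (inr c) => fF (g c)
  end.

Definition flat_sign (sgn : V -> E -> F -> bool) (x y z : face) : bool :=
  match x, y, z with
  | inr (inl (inl v)), inr (inl (inr e)), inr (inr c) => sgn v e c
  | _, _, _ => false
  end.

Lemma flat_automorphism sgn a b g : map_symmetry e0 e1 f0 f1 sgn a b g ->
  exists2 s : {perm face}, s \in automorphisms face & s =1 flat_action a b g.
Proof.
move=> S; have actK : involutive (flat_action a b g).
  by move=> [t|[[v|e]|c]] //=; rewrite ?(sym_vertex S) ?(sym_edge S) ?(sym_face S).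
exists (perm (inv_inj actK)); last by move=> x; rewrite permE.
rewrite inE; apply/forallP=> x; apply/forallP=> y; rewrite !permE; apply/eqP.
change (flat_le (flat_action a b g x) (flat_action a b g y) = flat_le x y).
case: x => [[]|[[v|e]|c]]; case: y => [[]|[[v'|e']|c']] //=.
- by rewrite (inj_eq (inv_inj (sym_vertex S))).
- by rewrite (sym_vertex_edge S).
- by rewrite (inj_eq (inv_inj (sym_edge S))).
- by rewrite (sym_face_edge S).
- by rewrite (inj_eq (inv_inj (sym_face S))).
Qed.

Lemma reflexible_map_polyhedron : 1 < p -> 1 < q ->
    reflexible_map e0 e1 f0 f1 p q ->
  exists (d : Order.disp_t) (P : finTBPOrderType d) (rk : P -> int),
    [/\ is_polyhedron rk, has_type rk p q, tight P p q & orientably_regular rk].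
Proof.
move=> p1 q1 [ne nf cF cV cE [sgn [v [e [c [ve ce]]]]]].
case=> a0 [b0 [g0 [S0 [x0 y0 z0]]]].
case=> a1 [b1 [g1 [S1 [x1 y1 z1]]]].
case=> a2 [b2 [g2 [S2 [x2 y2 z2]]]].
have [r0 A0 E0] := flat_automorphism S0.
have [r1 A1 E1] := flat_automorphism S1.
have [r2 A2 E2] := flat_automorphism S2.
have polyP := flat_polyhedron ne nf p1 q1 cF cV e.
have typeP := flat_type ne nf p1 q1 cF cV.
have tightP : tight face p q by rewrite /tight (card_flat_flags ne nf p1 q1 cF cV e).
exists (Order.Disp tt tt), face, (@flat_rank V E F e0 e1 f0 f1); split=> //.
have fl : is_flag (fV v) (fE e) (fF c) by rewrite flat_flagE ve.
apply: (orientably_regular_count polyP typeP p1 q1 tightP fl (r0 := r0) (r1 := r1) (r2 := r2)).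
- by apply/(reflection0P polyP r0 fl); rewrite A0 !E0 /= y0 z0; split=> // -[].
- by apply/(reflection1P polyP r1 fl); rewrite A1 !E1 /= x1 z1; split=> // -[].
- by apply/(reflection2P polyP r2 fl); rewrite A2 !E2 /= x2 y2; split=> // -[].
apply: (sign_not_rotation (sgn := flat_sign sgn) fl) => r.
have flip a b g (S : map_symmetry e0 e1 f0 f1 sgn a b g) (s : {perm face}) :
    s =1 flat_action a b g -> forall x y z, is_flag x y z ->
  flat_sign sgn (s x) (s y) (s z) = ~~ flat_sign sgn x y z.
  move=> sE x y z /flat_is_flag[v' [e' [c' [-> -> -> /andP[ve' ce']]]]].
  by rewrite !sE /= (sym_sign S).
by case/setUP=> [/set2P[]|/set1P] ->; split=> //;
  [exact: (flip _ _ _ S0 _ E0) | exact: (flip _ _ _ S1 _ E1) | exact: (flip _ _ _ S2 _ E2)].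
Qed.

End Realization.

(** * The twisted maps *)

Section TwistedMap.
Local Open Scope ring_scope.
Variables (K : finZmodType) (u : K) (n' : nat).
Local Notation N := 'I_n'.+2.
Variables (t : N -> K) (neg : bool).
Hypothesis u_inj : forall i j : nat, (i < #|K|)%N -> (j < #|K|)%N ->
  u *+ i = u *+ j -> i = j.
Let sg (x : K) : K := if neg then - x else x.
(** [tN] and [tR] make the maps [- a] and [- 1 - a] on edge classes extend to symmetries. [tS], with
    [u] a generator of [K], makes each 2-face pass through all vertices. *)
Hypotheses (t0 : t 0 = 0) (tN : forall a, t (- a) = sg (t a)).
Hypotheses (tR : forall a, t (- 1 - a) = - u - t a).
Hypothesis (tS : forall a, t (a + 1) - t a = u \/ t (a + 1) - t a = - u).

Local Notation vertex := (bool * K)%type.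
Local Notation edge := (N * K)%type.

Definition white_end (e : edge) : vertex := (false, e.2).
Definition black_end (e : edge) : vertex := (true, e.2 + t e.1).
Definition left_side (e : edge) : N := e.1.
Definition right_side (e : edge) : N := e.1 + 1.

Lemma incident_ends (v : vertex) (e : edge) :
  incident white_end black_end v e = (v.2 == if v.1 then e.2 + t e.1 else e.2).
Proof. by case: v => [[] x]; rewrite /incident /= ?orbF. Qed.

Lemma incident_sides c (e : edge) :
  incident left_side right_side c e = (c == e.1) || (c == e.1 + 1).
Proof. by []. Qed.

Lemma neq_succ (a : N) : a != a + 1.
Proof. by rewrite -{1}[a]addr0 (inj_eq (addrI a)) eq_sym oner_neq0. Qed.

Lemma ordS_succ (a : N) : ordS a = a + 1.
Proof. by apply: val_inj; rewrite /= modnDmr addn1. Qed.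

Lemma sgK : involutive sg.
Proof. by move=> x; rewrite /sg; case: neg; rewrite ?opprK. Qed.

Lemma sgD x y : sg (x + y) = sg x + sg y.
Proof. by rewrite /sg; case: neg; rewrite ?opprD. Qed.

Lemma twisted_vertex_cycles : cycles_around left_side right_side white_end black_end n'.+2.
Proof.
move=> [s x]; exists id, (fun j => (j, if s then x - t j else x)); split.
- by exists id.
- by move=> i j [].
- move=> [a b]; rewrite incident_ends /=; apply/eqP/codomP=> [->|[j [-> ->]]].
    by exists a; case: s; rewrite ?addrK.
  by case: s; rewrite ?subrK.
- by move=> j; rewrite !incident_sides /= eqxx ordS_succ eqxx orbT.
Qed.

(** Around [c], edges of the classes [c] and [c - 1] alternate: from the white vertex [dt *+ i]
    through the black vertex [dt *+ i + t c] to the white vertex [dt *+ i.+1]. As [dt] is [u] or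
    [- u], it generates [K] and every vertex is met once. *)
Lemma twisted_face_cycles :
  cycles_around white_end black_end left_side right_side (2 * #|K|)%N.
Proof.
move=> c; pose dt := t c - t (c - 1).
have dtP : dt = u \/ dt = - u by have := tS (c - 1); rewrite subrK.
have dt_inj i j : (i < #|K|)%N -> (j < #|K|)%N -> dt *+ i = dt *+ j -> i = j.
  move=> iK jK; case: dtP => ->; first exact: u_inj.
  by rewrite !mulNrn => /oppr_inj; apply: u_inj.
have dt_surj x : exists2 i, (i < #|K|)%N & dt *+ i = x.
  have inj : injective (fun i : 'I_#|K| => dt *+ i).
    by move=> i j /(dt_inj _ _ (ltn_ord i) (ltn_ord j))/val_inj.
  have [g _ gK] := inj_card_bij inj (eq_leq (esym (card_ord _))).
  by exists (g x); [exact: ltn_ord | exact: gK].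
(* Some multiple [dt *+ i] with [i < #|K|] equals [- dt], so [dt *+ i.+1 = 0]; injectivity below
   [#|K|] leaves only [i.+1 = #|K|]. *)
have dtK : dt *+ #|K| = 0.
  have [i iK e] := dt_surj (- dt).
  suff <- : i.+1 = #|K| by rewrite mulrS e subrr.
  apply/eqP; rewrite eqn_leq iK leqNgt /=; apply/negP=> iK'.
  by have /(dt_inj i.+1 0%N iK') : dt *+ i.+1 = dt *+ 0; [rewrite mulrS e subrr | case/(_ (leq_ltn_trans (leq0n _) iK'))].
have dt_mod i : dt *+ (i %% #|K|) = dt *+ i.
  by rewrite [in RHS](divn_eq i #|K|) mulrnDr mulnC mulrnA dtK mul0rn add0r.
have tc : t c = dt + t (c - 1) by rewrite /dt subrK.
have half_lt (j : 'I_(2 * #|K|)) : (j./2 < #|K|)%N.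
  by rewrite ltn_half_double -mul2n.
have eq_half (i j : 'I_(2 * #|K|)) : odd i = odd j -> (i./2 = j./2)%N -> i = j.
  move=> eo eh; apply: val_inj => /=.
  by rewrite -(odd_double_half i) -(odd_double_half j) eo eh.
pose a (j : 'I_(2 * #|K|)) : vertex :=
  if odd j then (true, dt *+ j./2 + t c) else (false, dt *+ j./2).
pose b (j : 'I_(2 * #|K|)) : edge :=
  if odd j then (c - 1, dt *+ j./2.+1) else (c, dt *+ j./2).
have cc : c != c - 1 by have := neq_succ (c - 1); rewrite subrK eq_sym.
exists a, b; split.
- have inja : injective a.
    move=> i j; rewrite /a; case oi: (odd i); case oj: (odd j) => // -[].
      move/addIr/dt_inj => /(_ (half_lt i) (half_lt j)).
      by apply: eq_half; rewrite oi.
    move/dt_inj => /(_ (half_lt i) (half_lt j)).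
    by apply: eq_half; rewrite oi.
  by apply: inj_card_bij inja _; rewrite card_prod card_bool card_ord.
- move=> i j; rewrite /b; case oi: (odd i); case oj: (odd j) => // -[].
  + rewrite !mulrS => /addrI/dt_inj => /(_ (half_lt i) (half_lt j)).
    by apply: eq_half; rewrite oi.
  + by move/eqP; rewrite eq_sym (negPf cc).
  + by move/eqP; rewrite (negPf cc).
  + move/dt_inj => /(_ (half_lt i) (half_lt j)).
    by apply: eq_half; rewrite oi.
- move=> [x y]; rewrite incident_sides /=; apply/orP/codomP=> [[]/eqP cx|[j]].
  + have [i iK <-] := dt_surj y.
    have j_lt : (i.*2 < 2 * #|K|)%N by rewrite mul2n ltn_double.
    by exists (Ordinal j_lt); rewrite /b /= odd_double doubleK cx.
  + have [i iK e] := dt_surj (y - dt).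
    have j_lt : (i.*2.+1 < 2 * #|K|)%N by rewrite mul2n ltn_Sdouble.
    exists (Ordinal j_lt); rewrite /b /= odd_double /= uphalf_double mulrS e addrC subrK.
    by rewrite cx addrK.
  + by rewrite /b; case: (odd j) => -[-> _]; rewrite ?subrK eqxx; [right | left].
- move=> j; rewrite !incident_ends /a /b.
  have jE := odd_double_half j; case oj: (odd j) jE => jE /=.
    have -> : (j.+1 %% (2 * #|K|))%N = (j./2.+1 %% #|K|).*2.
      have -> : (j.+1 = 2 * j./2.+1)%N by lia.
      by rewrite -muln_modr mul2n.
    rewrite odd_double doubleK /= {1}tc addrA -mulrSr eqxx /=.
    by rewrite dt_mod.
  have j_lt : (j.+1 < 2 * #|K|)%N.
    rewrite ltn_neqAle ltn_ord andbT; apply/eqP=> /(congr1 odd).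
    by rewrite /= oj oddM.
  by rewrite modn_small //= oj /= uphalf_half oj add0n !eqxx.
Qed.

(** Adjacent flags get opposite signs: the ends of an edge differ in colour, exactly one side of it
    is its class, and the two edges at a vertex of [c] have classes [c] and [c - 1]. *)
Definition twisted_sign (v : vertex) (e : edge) (c : N) : bool := v.1 (+) (c == e.1).

Lemma eq_succ_neg (a c : N) : (c == a) || (c == a + 1) -> (c == a + 1) = ~~ (c == a).
Proof.
case/orP=> /eqP->; rewrite eqxx; first by rewrite (negPf (neq_succ a)).
by rewrite eq_sym neq_succ.
Qed.

(** The colours are exchanged and all 2-faces fixed; the new white end of an edge is minus its old
    black end. *)
Lemma twisted_reflection0 : map_symmetry white_end black_end left_side right_side twisted_sign
  (fun v => (~~ v.1, - v.2)) (fun e => (e.1, - e.2 - t e.1)) id.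
Proof.
split=> //.
- by move=> [s x]; rewrite /= negbK opprK.
- by move=> [a b]; rewrite /= opprB addrAC addrN add0r ?opprK.
- move=> [s x] [a b]; rewrite !incident_ends /=; case: s => /=.
    by rewrite -opprD eqr_opp.
  by rewrite subrK eqr_opp.
- by move=> [s x] [a b] c _ _; rewrite /twisted_sign /= addNb.
Qed.

(** Negating 2-faces sends the class [a], lying between [a] and [a + 1], to [- 1 - a]; by [tR] the
    black vertices must then move by [- u - x]. *)
Lemma twisted_reflection1 : map_symmetry white_end black_end left_side right_side twisted_sign
  (fun v => (v.1, if v.1 then - u - v.2 else - v.2)) (fun e => (- 1 - e.1, - e.2)) (fun c => - c).
Proof.
split.
- by move=> [[] x]; rewrite /= ?opprK // opprB addrC subrK.
- by move=> [a b]; rewrite /= opprK opprB addrC subrK.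
- exact: opprK.
- move=> [s x] [a b]; rewrite !incident_ends /=; case: s => /=.
    by rewrite tR addrCA (inj_eq (addrI _)) -opprD eqr_opp.
  by rewrite eqr_opp.
- move=> c [a b]; rewrite !incident_sides /= addrAC addNr add0r [- 1 - a]addrC -opprD.
  by rewrite !eqr_opp orbC.
- move=> [s x] [a b] c _; rewrite incident_sides /twisted_sign /= => /eq_succ_neg ce.
  by rewrite -addbN -ce [- 1 - a]addrC -opprD eqr_opp.
Qed.

(** [1 - c] exchanges the two sides 0 and 1 of the class 0; by [tN] the same map [sg] works for both
    colours. *)
Lemma twisted_reflection2 : map_symmetry white_end black_end left_side right_side twisted_sign
  (fun v => (v.1, sg v.2)) (fun e => (- e.1, sg e.2)) (fun c => 1 - c).
Proof.
have inj_sg : injective sg := inv_inj sgK.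
split.
- by move=> [s x]; rewrite /= sgK.
- by move=> [a b]; rewrite /= sgK opprK.
- by move=> c; rewrite opprB addrC subrK.
- move=> [s x] [a b]; rewrite !incident_ends /=; case: s => /=.
    by rewrite tN -sgD (inj_eq inj_sg).
  by rewrite (inj_eq inj_sg).
- move=> c [a b]; rewrite !incident_sides /= orbC [- a + 1]addrC (inj_eq (addrI _)) eqr_opp.
  by congr (_ || _); rewrite subr_eq addrC -subr_eq opprK eq_sym addrC.
- move=> [s x] [a b] c _; rewrite incident_sides /twisted_sign /= => /eq_succ_neg ce.
  by rewrite -addbN -ce subr_eq addrC -subr_eq opprK eq_sym addrC.
Qed.

Lemma twisted_map :
  reflexible_map white_end black_end left_side right_side (2 * #|K|)%N n'.+2.
Proof.
split.
- by move=> e.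
- by move=> e; apply: neq_succ.
- exact: twisted_face_cycles.
- exact: twisted_vertex_cycles.
- have -> : #|{: N * K}| = (n'.+2 * #|K|)%N by rewrite card_prod card_ord.
  by rewrite [(_ * #|K|)%N]mulnC !mulnA.
exists twisted_sign, (false, 0), (0, 0), 0; split.
- by rewrite incident_ends.
- by rewrite incident_sides eqxx.
- do 3 eexists; split; first exact: twisted_reflection0.
  by rewrite /= t0 !oppr0 addr0.
- do 3 eexists; split; first exact: twisted_reflection1.
  have nz : - 1 - 0 != 0 :> N by rewrite subr0 oppr_eq0 oner_eq0.
  split; [by rewrite /= oppr0 | by move/(congr1 fst)/eqP; apply/negP | exact: oppr0].
- do 3 eexists; split; first exact: twisted_reflection2.
  rewrite /= /sg !oppr0 addr0 if_same; split=> //.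
Qed.

End TwistedMap.

(** * The two families of twists and the assembly of all types *)

Definition has_reflexible_map (p q : nat) : Prop :=
  exists (V E F : finType) (e0 e1 : E -> V) (f0 f1 : E -> F),
    reflexible_map e0 e1 f0 f1 p q.

Section Twists.
Local Open Scope ring_scope.
Variables k n : nat.
Local Notation K := 'I_k.+1.
Local Notation N := 'I_n.+2.

Lemma Zp1_mulrn_inj (i j : nat) : (i < #|K|)%N -> (j < #|K|)%N ->
  (Zp1 : K) *+ i = Zp1 *+ j -> i = j.
Proof.
rewrite card_ord => ik jk; rewrite !Zp_mulrn => /(congr1 val) /=.
by rewrite !modnMml !mul1n !modn_small.
Qed.

(** Divisibility makes reduction modulo [k.+1] additive on the edge classes: the twist is an odd
    function and always grows by the generator. *)
Lemma divisor_map : (k.+1 %| n.+2)%N -> has_reflexible_map (2 * k.+1) n.+2.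
Proof.
move=> kn; pose t (a : N) : K := inZp a.
have tD a b : t (a + b) = t a + t b.
  by apply: val_inj; rewrite /= modn_dvdm // modnDm.
have t0 : t 0 = 0 by apply: val_inj; rewrite /= mod0n.
have tN a : t (- a) = - t a by apply/eqP; rewrite -addr_eq0 -tD addNr t0.
have t1 : t 1 = Zp1 by apply: val_inj; rewrite /= modn_dvdm.
exists _, _, _, (@white_end K n), (@black_end K n t), (@left_side K n), (@right_side K n).
rewrite -[X in (2 * X)%N]card_ord; apply: (@twisted_map _ Zp1 _ _ true) => //.
- exact: Zp1_mulrn_inj.
- by move=> a; rewrite tD !tN t1.
- by move=> a; left; rewrite tD t1 addrC addKr.
Qed.

(** Parity is well defined modulo an even number, so the twist is an even function whose increments
    alternate in sign. With [t 0 = 0], the condition [tR] forces the value [- Zp1] at [- 1], hence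
    the minus sign. *)
Lemma even_map : ~~ odd n -> has_reflexible_map (2 * k.+1) n.+2.
Proof.
move=> en; pose t (a : N) : K := if odd a then - Zp1 else 0.
have oD (a b : N) : odd (a + b)%R = odd a (+) odd b.
  by rewrite /= odd_mod ?oddD //= negbK; apply: negbTE.
have oN (a : N) : odd (- a)%R = odd a.
  by have := oD a (- a); rewrite subrr /= => /esym; case: odd; case: odd.
have o1 : odd (1%R : N) by rewrite -[odd _]/(odd (1 %% n.+2)) modn_small.
exists _, _, _, (@white_end K n), (@black_end K n t), (@left_side K n), (@right_side K n).
rewrite -[X in (2 * X)%N]card_ord; apply: (@twisted_map _ Zp1 _ _ false) => //.
- exact: Zp1_mulrn_inj.
- by move=> a; rewrite /t oN.
- by move=> a; rewrite /t oD !oN o1; case: (odd a); rewrite /= ?subrr ?subr0.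
- move=> a; rewrite /t oD o1; case: (odd a); rewrite /= ?opprK ?add0r ?subr0.
    by left.
  by right.
Qed.

End Twists.

Theorem theorem3p4 (p q : nat) (hp : 2 <= p) (hq : 2 <= q) :
  (exists (d : Order.disp_t) (P : finTBPOrderType d) (rk : P -> int),
     [/\ is_polyhedron rk, has_type rk p q, tight P p q
       & orientably_regular rk])
  <->
  [\/ ~~ odd p /\ ~~ odd q,
      [/\ odd p, ~~ odd q & q %| 2 * p]
    | [/\ odd q, ~~ odd p & p %| 2 * q]].
Proof.
split=> [[d [P [rk [polyP typeP tightP orP]]]]|cond].
  have [] := tight_orientably_regular_condition polyP typeP hp hq tightP orP.
  case: (boolP (odd p)) => op; case: (boolP (odd q)) => oq //= _ hpq hqp.
  - by constructor 2; rewrite hpq.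
  - by constructor 3; rewrite hqp.
  - by constructor 1.
have realize m n : 1 < m -> 1 < n -> has_reflexible_map m n ->
    exists (d : Order.disp_t) (P : finTBPOrderType d) (rk : P -> int),
      [/\ is_polyhedron rk, has_type rk m n, tight P m n & orientably_regular rk].
  by move=> m1 n1 [V [E [F [e0 [e1 [f0 [f1]]]]]]]; apply: reflexible_map_polyhedron.
have dual m n : has_reflexible_map m n -> has_reflexible_map n m.
  case=> V [E [F [e0 [e1 [f0 [f1 M]]]]]].
  by exists F, E, V, f0, f1, e0, e1; apply: reflexible_map_dual.
have evenE m : 1 < m -> ~~ odd m -> exists k, m = (2 * k.+1)%N.
  move=> m1 em; exists m./2.-1; rewrite prednK ?half_gt0 // mul2n.
  by rewrite -[LHS]odd_double_half (negPf em).
(* Only types with an even first entry are built directly; for [m = 2 * k.+1], [m] divides [2 * n]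
   exactly when [k.+1] divides [n]. Case (b) follows by duality. *)
have map m n : 1 < m -> 1 < n -> ~~ odd m -> ~~ odd n || (m %| 2 * n) ->
    has_reflexible_map m n.
  move=> m1 n1 em; have [k ->] := evenE m m1 em; case: n n1 => [|[|n]] // _.
  case/orP=> [/= en|]; first by apply: even_map; rewrite negbK in en.
  by rewrite dvdn_pmul2l //; apply: divisor_map.
apply: realize => //; case: cond => [[ep eq]|[_ eq dv]|[_ ep dv]].
- by apply: map; rewrite ?eq.
- by apply: dual; apply: map; rewrite ?dv ?orbT.
- by apply: map; rewrite ?dv ?orbT.
Qed.
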